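(* Let $M\in\mathbb{N}$, $T>0$, $\Delta t=T/M$, $x_0\in(l,r)$, and assume (A1), (A2), (A3). Let $X^{LS}_m=\Phi^{-1}(Y^{LS}_m)$, where $(Y^{LS}_m)_{m=0}^M$ is the semi-analytic Lamperti-splitting scheme, and let $X$ be the exact solution. Then for every $p\ge1$, $$\Big(\mathbb{E}\Big[\sup_{m=0,\dots,M}|X^{LS}_m-X(t_m)|^p\Big]\Big)^{1/p}\le C\,\Delta t,$$ where $C$ depends only on $p$, $L_{\Phi^{-1}}$, $L_H$, $T$ and $\mu$ (and not on $M$).
   Context: Let $l<r$ be real numbers and $f,g:\mathbb{R}\to\mathbb{R}$. (A1): $f|_{[l,r]}\in C^{2}([l,r])$. (A2): $g|_{[l,r]}\in C^{3}([l,r])$, $g>0$ on $(l,r)$, and for every $w_0\in(l,r)$, $\int_{w_0}^{l}\frac{dw}{g(w)}=-\infty$, $\int_{w_0}^{r}\frac{dw}{g(w)}=+\infty$. (A3): $\lim_{x\searrow l}f(x)/g(x)$ and $\lim_{x\nearrow r}f(x)/g(x)$ exist and are finite. Fix $w_0\in(l,r)$, let $\Phi(x)=\int_{w_0}^{x}\frac{dw}{g(w)}$ for $x\in(l,r)$ (a bijection $(l,r)\to\mathbb{R}$ whose inverse is globally Lipschitz with constant $L_{\Phi^{-1}}$), fix $\mu\in\mathbb{R}$, set $\tilde H(x)=\frac{f(\Phi^{-1}(x))}{g(\Phi^{-1}(x))}-\frac12 g'(\Phi^{-1}(x))$, $H=\tilde H-\mu$, and $L_H=\sup_{\mathbb{R}}|H+\mu|+\sup_{\mathbb{R}}|H'|+\sup_{\mathbb{R}}|H''|$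 (finite). Let $B$ be a standard Brownian motion on a filtered probability space satisfying the usual conditions. Exact solution: let $Y$ be the unique strong solution on $[0,T]$ of $dY(t)=\tilde H(Y(t))\,dt+dB(t)$, $Y(0)=\Phi(x_0)$, and $X=\Phi^{-1}(Y)$; $X$ is the strong solution of $dX(t)=f(X(t))\,dt+g(X(t))\,dB(t)$, $X(0)=x_0$, and takes values in $(l,r)$. Let $t_m=m\Delta t$. Semi-analytic Lamperti-splitting scheme: $Y^{LS}_0=\Phi(x_0)$; given $Y^{LS}_m$, let $y_m$ be the exact solution on $[t_m,t_{m+1}]$ of $y_m'(t)=H(y_m(t))$, $y_m(t_m)=Y^{LS}_m$, and set $Y^{LS}_{m+1}=y_m(t_{m+1})+\mu\Delta t+B(t_{m+1})-B(t_m)$. *)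

(* Defs.v *)
From HB Require Import structures.
From mathcomp Require Import all_boot all_order all_algebra.
From mathcomp Require Import all_classical all_reals all_analysis.
Set Implicit Arguments. Unset Strict Implicit. Unset Printing Implicit Defensive.
Import Order.TTheory GRing.Theory Num.Theory.
Import numFieldNormedType.Exports.
Local Open Scope classical_set_scope.
Local Open Scope ring_scope.

Section defs.
Context {R : realType}.

(* f restricted to [l,r] is C^k([l,r]): derivatives up to order k exist on the
   closed interval (one-sided at the endpoints) and are continuous on [l,r]. *)
Definition Ck_on (l r : R) (k : nat) (f : R -> R) : Prop :=
  exists d : nat -> R -> R,
    d 0%N = f /\
    (forall i, (i <= k)%N -> {within `[l, r], continuous (d i)}) /\
    (forall i, (i < k)%N -> forall x, x \in `[l, r] ->
       (fun y => (d i y - d i x) / (y - x))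
         @ within [set y | y \in `[l, r] /\ y != x] (nbhs x) --> d i.+1 x).

Definition Phi (g : R -> R) (w0 x : R) : R :=
  if w0 <= x then Rintegral lebesgue_measure `[w0, x] (fun w => (g w)^-1)
  else - Rintegral lebesgue_measure `[x, w0] (fun w => (g w)^-1).

Definition Htilde (f g Phiinv : R -> R) (x : R) : R :=
  f (Phiinv x) / g (Phiinv x) - 2^-1 * derive1 g (Phiinv x).

Definition brownian_motion d (Om : measurableType d) (P : probability Om R)
    (B : R -> Om -> R) : Prop :=
  (forall t, 0 <= t -> measurable_fun setT (B t)) /\
  {ae P, forall w, B 0 w = 0 /\ continuous (B^~ w)} /\
  (forall s t, 0 <= s -> s < t -> forall A : set R, measurable A ->
     P [set w | B t w - B s w \in A] = normal_prob 0 (Num.sqrt (t - s)) A) /\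
  (forall (n : nat) (tau : nat -> R), 0 <= tau 0%N ->
     (forall i, (i < n)%N -> tau i < tau i.+1) ->
     forall A : nat -> set R, (forall i, measurable (A i)) ->
     P (\bigcap_(i in [set k | (k < n)%N])
          [set w | B (tau i.+1) w - B (tau i) w \in A i]) =
     (\prod_(i < n) P [set w | (B (tau i.+1) w - B (tau i) w)%R \in A i])%E).

End defs.

(* Main.v *)
Require Import Defs.
From HB Require Import structures.
From mathcomp Require Import all_boot all_order all_algebra.
From mathcomp Require Import all_classical all_reals all_analysis.
From mathcomp Require Import measurable_realfun.
From mathcomp Require Import ring lra zify.
Import Order.TTheory GRing.Theory Num.Theory.
Import numFieldNormedType.Exports.
Local Open Scope classical_set_scope.
Local Open Scope ring_scope.

(** The errors e_m = Y^LS_m - Y(t_m) obey a recursion in which the Brownian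
    increments cancel.  Expanding H around the numerical value Y^LS_m (a
    function of the increments of B up to t_m) rather than around Y(t_m) leaves
      |e_(m+1) - e_m + H'(Y^LS_m) zeta_m| <= dt L |e_m| + c dt^2 + L q_m,
    where zeta_m and q_m are the integrals of B - B(t_m) and of its square over
    [t_m, t_(m+1)].  No path integral is needed: both are replaced by Riemann
    sums with K nodes per step, which is harmless for K large depending on the
    path, and K tends to infinity at the very end by Fatou's lemma.
    The sum of the H'(Y^LS_m) zeta_m is dt times a transform of the independent
    Gaussian increments of B by bounded predictable coefficients; its even
    moments are bounded by a one-step recursion and its maximum by a
    trajectorial form of Doob's inequality.  Discrete Gronwall concludes, and
    u^p <= 1 + u^q reduces p to a large even exponent q.
    The suprema defining L_H are those of bounded functions because
    (Phi^-1)' = g o Phi^-1 and f/g is bounded. *)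

(** * Inequalities for powers, Doob's inequality along a path, discrete recursions *)

Section power_inequalities.
Context {R : realType}.
Implicit Types (a x y z s : R) (n k : nat).

(** Each zeta_m has size dt^(3/2), so adding the absolute values of the M terms would give order 1/2
    only. Order one rests on their being uncorrelated, which keeps the maximum of the partial sums
    of size dt; for this the coefficient of zeta_m must be a function of the increments before t_m.
    The scheme is such a function by induction on m, because the flow of H is Lipschitz in its
    starting point. About [Y], in contrast, only an integral equation along almost every path is
    known, neither adaptedness nor measurability. Hence every estimate that involves [Y] is made
    path by path and ends in a measurable majorant built from B and the scheme, whose expectation is
    bounded independently of K and M. Conditional expectations do not occur: a mean-zero term is
    expressed by the equality of the integrals of its positive and negative parts, and cancelling
    these requires their finiteness each time. *)

Lemma exprn_ge_tangent y z k : 0 <= y -> 0 <= z ->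
  z ^+ k + k%:R * z ^+ k.-1 * (y - z) <= y ^+ k.
Proof.
move=> y0 z0; elim: k => [|k IH]; first by rewrite !expr0 mul0r mul0r addr0.
rewrite [y ^+ k.+1]exprS; apply: le_trans (ler_wpM2l y0 IH).
case: k {IH} => [|k]; first by rewrite /= !expr0 expr1; lra.
rewrite /= !exprS -![k.+2%:R]natr1 -![k.+1%:R]natr1.
have zk : 0 <= z ^+ k by rewrite exprn_ge0.
rewrite -subr_ge0.
have -> : y * (z * z ^+ k + (k%:R + 1) * z ^+ k * (y - z)) -
   (z * (z * z ^+ k) + (k%:R + 1 + 1) * (z * z ^+ k) * (y - z)) =
   (k%:R + 1) * z ^+ k * (y - z) ^+ 2 by ring.
by rewrite mulr_ge0 ?sqr_ge0// mulr_ge0// addr_ge0.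
Qed.

(** Convexity on the whole line, from the tangent inequality at the squares, since (a + x)^2 - a^2
    exceeds 2 a x by x^2. It serves Jensen's inequality and the submartingale property of even
    powers. *)
Lemma exprn_even_ge_tangent a x n : ~~ odd n ->
  a ^+ n + n%:R * a ^+ n.-1 * x <= (a + x) ^+ n.
Proof.
move=> en; have -> : n = (2 * n./2)%N by rewrite mul2n even_halfK.
move: (n./2) => k {n en}; rewrite !exprM.
have := @exprn_ge_tangent ((a + x) ^+ 2) (a ^+ 2) k (sqr_ge0 _) (sqr_ge0 _).
apply: le_trans; rewrite lerD2l.
case: k => [|k]; first by rewrite muln0 !mul0r.
rewrite [in X in X.-1]mulnS add2n /= -exprM exprS.
have a2k : 0 <= a ^+ (2 * k) by rewrite exprM exprn_ge0// sqr_ge0.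
rewrite -subr_ge0 natrM.
set c := (k.+1)%:R; have c0 : 0 <= c by rewrite ler0n.
have -> : c * a ^+ (2 * k) * ((a + x) ^+ 2 - a ^+ 2) -
    2%:R * c * (a * a ^+ (2 * k)) * x = c * a ^+ (2 * k) * x ^+ 2 by ring.
by rewrite mulr_ge0 ?sqr_ge0// mulr_ge0.
Qed.

(** The linear term is isolated because it has mean zero once x is a centred increment times a
    coefficient from the past. The factor [n ^ 2] absorbs what the induction adds, as (n+1)^2 +
    (n+1) <= (n+2)^2. *)
Lemma exprDn_taylor1 s x n :
  `|(s + x) ^+ n - s ^+ n - n%:R * s ^+ n.-1 * x|
    <= (n ^ 2)%:R * x ^+ 2 * (`|s| + `|x|) ^+ n.-2.
Proof.
elim: n => [|n IH]; first by rewrite !expr0 !mul0r !subr0 subrr normr0.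
case: n IH => [_|n IH]; first by rewrite !expr1 /= !expr0 !mulr1 mul1r [s + x]addrC addrK subrr normr0 mul1r sqr_ge0.
have -> : (s + x) ^+ n.+2 - s ^+ n.+2 - n.+2%:R * s ^+ n.+1 * x =
  (s + x) * ((s + x) ^+ n.+1 - s ^+ n.+1 - n.+1%:R * s ^+ n * x)
   + n.+1%:R * s ^+ n * x ^+ 2.
  rewrite -[n.+2%:R]natr1 !exprS; ring.
apply: le_trans (ler_normD _ _) _.
rewrite !normrM [X in _ + X](_ : _ = n.+1%:R * `|s| ^+ n * x ^+ 2); last first.
  by rewrite normrX normr_nat -expr2 real_normK ?num_real.
set v := `|s| + `|x|; have v0 : 0 <= v by rewrite addr_ge0.
have sv : `|s| ^+ n <= v ^+ n by rewrite lerXn2r// ?nnegrE// lerDl.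
have x2 : 0 <= x ^+ 2 := sqr_ge0 x.
apply: (@le_trans _ _ ((n.+1 ^ 2)%:R * x ^+ 2 * v ^+ n
   + n.+1%:R * v ^+ n * x ^+ 2)); last first.
  have vn : 0 <= v ^+ n by exact: exprn_ge0.
  rewrite [n.+2.-2]/= [leRHS](_ : _ = (n.+2 ^ 2)%:R * v ^+ n * x ^+ 2); last by ring.
  rewrite [X in X + _](_ : _ = (n.+1 ^ 2)%:R * v ^+ n * x ^+ 2); last by ring.
  rewrite -!mulrDl ler_wpM2r// ler_wpM2r// -natrD ler_nat !expnS expn0.
  by rewrite !muln1 !mulSn !mulnS; lia.
apply: lerD; last by rewrite ler_wpM2r// ler_wpM2l.
case: n IH {sv} => [|n] IH.
  by rewrite !expr1 !expr0 !mulr1 !mul1r [s + x]addrC addrK subrr normr0 mulr0.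
apply: (@le_trans _ _ (v * ((n.+2 ^ 2)%:R * x ^+ 2 * v ^+ n))).
  by apply: ler_pM => //; exact: ler_normD.
by rewrite (exprS v n) mulrCA.
Qed.

Lemma exprDn_le_cst x y n : 0 <= x -> 0 <= y ->
  (x + y) ^+ n <= 2 ^+ n * (x ^+ n + y ^+ n).
Proof.
move=> x0 y0; have [xy|/ltW xy] := leP x y.
  apply: (@le_trans _ _ ((2 * y) ^+ n)).
    by rewrite lerXn2r ?nnegrE//; lra.
  by rewrite exprMn ler_wpM2l ?exprn_ge0// lerDr exprn_ge0.
apply: (@le_trans _ _ ((2 * x) ^+ n)).
  by rewrite lerXn2r ?nnegrE//; lra.
by rewrite exprMn ler_wpM2l ?exprn_ge0// lerDl exprn_ge0.
Qed.

Lemma exprn_le1D_even x n k : (k <= n)%N -> ~~ odd n -> `|x| ^+ k <= 1 + x ^+ n.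
Proof.
move=> kn en; have -> : x ^+ n = `|x| ^+ n.
  by rewrite -normrX ger0_norm// exprn_even_ge0.
have [x1|x1] := leP `|x| 1.
  by rewrite (le_trans (exprn_ile1 _ _ _))// lerDl exprn_ge0.
by rewrite (le_trans (ler_weXn2l (ltW x1) kn))// lerDr.
Qed.

(** Jensen's inequality: in the sum of the tangents at the mean [a] the linear terms cancel. *)
Lemma mean_exprn_even (I : finType) (u : I -> R) n : (0 < #|I|)%N -> ~~ odd n ->
  ((\sum_i u i) / #|I|%:R) ^+ n <= (\sum_i u i ^+ n) / #|I|%:R.
Proof.
move=> I0 en; set a := _ / _; have I0' : (0 : R) < #|I|%:R by rewrite ltr0n.
rewrite ler_pdivlMr//.
apply: (@le_trans _ _ (\sum_i (a ^+ n + n%:R * a ^+ n.-1 * (u i - a)))).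
  rewrite big_split/= sumr_const -mulr_sumr sumrB sumr_const.
  rewrite -[a *+ _]mulr_natr /a divfK ?gt_eqF// subrr mulr0 addr0.
  by rewrite -[X in _ <= X]mulr_natr.
apply: ler_sum => i _; apply: le_trans (exprn_even_ge_tangent _ _ _ en) _.
by rewrite addrC subrK.
Qed.

(* Trajectorial form of Doob's L2 maximal inequality: the correction term is a
   martingale transform of x by its running maximum m. *)
Lemma doob_trajectorial (x m : nat -> R) N :
  (forall k, 0 <= x k) -> m 0%N = x 0%N ->
  (forall k, m k.+1 = Num.max (m k) (x k.+1)) ->
  m N ^+ 2 + 4 * \sum_(k < N) m k * (x k.+1 - x k) <= 4 * x N ^+ 2.
Proof.
move=> x0 m0 mS.
have xm k : 0 <= m k by elim: k => [|k IH]; rewrite ?m0// mS le_max IH.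
(* This bound persists when the maximum stays, and also when it moves up to the new value x, because
   m x - m^2/2 <= x^2/2. Four times it, together with (m - 2x)^2 >= 0, yields the constant 4. *)
suff H k : \sum_(j < k) m j * (x j.+1 - x j) + 2^-1 * m k ^+ 2 <= m k * x k.
  have := H N; set S := \sum_(_ < _) _ => HS.
  have : 0 <= (m N - 2 * x N) ^+ 2 by exact: sqr_ge0.
  move: HS; rewrite !expr2; lra.
elim: k => [|k IH]; first by rewrite big_ord0 add0r m0 expr2; have := x0 0%N; nra.
rewrite big_ord_recr/= mS; case: (leP (m k) (x k.+1)) => h.
  by move: IH h (xm k) (x0 k.+1); rewrite !expr2; nra.
by move: IH h (xm k) (x0 k.+1); rewrite !expr2; nra.
Qed.

Lemma discrete_gronwall (e : nat -> R) (A b : R) N : 0 <= A -> 0 <= b ->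
  (forall m, (m <= N)%N -> e m <= A + b * \sum_(k < m) e k) ->
  forall m, (m <= N)%N -> e m <= A * (1 + b) ^+ m.
Proof.
move=> A0 b0 H.
have S m : (m <= N)%N -> A + b * \sum_(k < m) e k <= A * (1 + b) ^+ m.
  elim: m => [|m IH] mN; first by rewrite big_ord0 mulr0 addr0 expr0 mulr1.
  have /IH IHm := ltnW mN; have em := H m (ltnW mN).
  by rewrite big_ord_recr/= exprS; nra.
by move=> m mN; apply: le_trans (H m mN) (S m mN).
Qed.

(** The quantity 1 + v grows at most by the factor 1 + K h per step, so the bound sees the grid only
    through the elapsed time [h *+ N]. *)
Lemma linear_recurrence_le (v : nat -> R) (K h : R) N : 0 <= K -> 0 <= h ->
  v 0%N <= 0 -> (forall i, (i < N)%N -> v i.+1 <= v i + K * h * (1 + v i)) ->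
  forall i, (i <= N)%N -> v i <= expR (K * (h *+ N)).
Proof.
move=> K0 h0 v0 vS i iN; have Kh : 0 <= K * h by exact: mulr_ge0.
have H : 1 + v i <= (1 + K * h) ^+ i.
  elim: i iN => [|i IH] iN; first by rewrite expr0; lra.
  by rewrite exprS; have := vS _ iN; have := IH (ltnW iN); nra.
have : (1 + K * h) ^+ i <= expR (K * (h *+ N)).
  rewrite mulrnAr -[_ *+ N]mulr_natl expRM_natl; apply: (@le_trans _ _ ((1 + K * h) ^+ N)).
    by apply: ler_weXn2l => //; lra.
  by rewrite lerXn2r ?nnegrE ?expR_ge0 ?expR_ge1Dx//; lra.
lra.
Qed.

(** [D j] is counted once for each later node. This turns the Riemann sum of B - B(t_m), whose terms
    are partial sums of increments, into a linear combination of increments. *)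
Lemma sum_partial_sums (D : nat -> R) K :
  \sum_(i < K) \sum_(j < i) D j = \sum_(j < K) (K - j.+1)%:R * D j.
Proof.
elim: K => [|K IH]; first by rewrite !big_ord0.
rewrite big_ord_recr/= IH [RHS]big_ord_recr/= subnn mul0r addr0 -big_split/=.
apply: eq_bigr => j _; rewrite subSS -[X in _ + X]mul1r -mulrDl natr1; congr (_%:R * _).
by rewrite subnSK.
Qed.

End power_inequalities.

(** * Gaussian moments and symmetry *)

Section gaussian.
Context {R : realType}.
Local Notation mu := (@lebesgue_measure R).

Lemma ge0_integral_normal_prob (s : R) (f : R -> \bar R) :
  measurable_fun [set: R] f -> (forall x, 0 <= f x)%E ->
  (\int[normal_prob 0 s]_x f x = \int[mu]_x (f x * (normal_pdf 0 s x)%:E))%E.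
Proof.
move=> mf f0.
have dom := @normal_prob_dominates R 0 s.
rewrite -(Radon_Nikodym_SigmaFinite.change_of_variables dom)//.
have iR := Radon_Nikodym_SigmaFinite.f_integrable dom.
have mpdf : measurable_fun [set: R] (fun x : R => (normal_pdf 0 s x)%:E).
  by apply/measurable_EFinP; exact: measurable_normal_pdf.
apply: ae_eq_integral => //.
- by apply: emeasurable_funM => //; exact: measurable_int iR.
- exact: emeasurable_funM.
- apply: ae_eqe_mul2l; apply: integral_ae_eq => //= E _ mE.
  by rewrite -Radon_Nikodym_SigmaFinite.f_integral.
Qed.

Lemma normal_probN (s : R) (A : set R) : s != 0 -> measurable A ->
  normal_prob 0 s (-%R @^-1` A) = normal_prob 0 s A.
Proof.
move=> s0 mA; rewrite /normal_prob.
transitivity (\int[pushforward mu (-%R : _ -> measurableTypeR R)]_(x in A)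
    (normal_pdf 0 s x)%:E)%E.
  rewrite ge0_integral_pushforward//.
  - apply: eq_integral => x _ /=; congr EFin.
    by rewrite normal_pdfE// /normal_fun !subr0 sqrrN.
  - apply: measurable_funTS; apply/measurable_EFinP; exact: measurable_normal_pdf.
  - by move=> x _; rewrite lee_fin normal_pdf_ge0.
by apply: eq_measure_integral => B mB _; exact: lebesgue_measureN.
Qed.

(** An upper bound for the normalised moment of order 2k, not its exact value: 2 is the ratio of the
    peaks of the densities with deviations s and 2s, the factorial comes from y^k <= k! e^y, and 8^k
    from y = x^2 / (8 s^2). *)
Definition gaussian_moment_cst (k : nat) : R := 2 * k`!%:R * 8 ^+ k.

(** With y = x^2 / (8 s^2) the two densities decay like e^(-4y) and e^(-y), which leaves room for
    y^k <= k! e^y. The moment bound then only uses that the wider density has integral one. *)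
Lemma exprn_normal_pdf_le (s x : R) k : 0 < s ->
  x ^+ (2 * k) * normal_pdf 0 s x <=
  gaussian_moment_cst k * s ^+ (2 * k) * normal_pdf 0 (2 * s) x.
Proof.
move=> s0; have sN0 : s != 0 by rewrite gt_eqF.
have s2N0 : 2 * s != 0 by rewrite mulf_neq0// pnatr_eq0.
have pk : normal_peak s = 2 * normal_peak (2 * s).
  rewrite /normal_peak (_ : (2 * s) ^+ 2 * pi *+ 2 = 2 ^+ 2 * (s ^+ 2 * pi *+ 2)); last by ring.
  by rewrite sqrtrM// sqrtr_sqr ger0_norm// invfM mulrA divff ?mul1r ?pnatr_eq0.
rewrite !normal_pdfE// pk /normal_fun !subr0.
pose y := x ^+ 2 / (8 * s ^+ 2).
have s20 : 0 <= 8 * s ^+ 2 by rewrite mulr_ge0// sqr_ge0.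
have y0 : 0 <= y by rewrite divr_ge0// sqr_ge0.
have -> : - x ^+ 2 / (s ^+ 2 *+ 2) = - (4 * y) by rewrite /y; field.
have -> : - x ^+ 2 / ((2 * s) ^+ 2 *+ 2) = - y by rewrite /y; field.
have xy : x ^+ (2 * k) = (8 * s ^+ 2) ^+ k * y ^+ k.
  by rewrite -exprMn exprM; congr (_ ^+ _); rewrite /y; field.
have yk : y ^+ k <= k`!%:R * expR y.
  case: (k) => [|n]; first by rewrite expr0 mul1r -expR0 ler_expR.
  rewrite mulrC -ler_pdivrMr ?ltr0n ?fact_gt0//.
  by apply: le_trans (expR_ge1Dxn n y0); rewrite lerDr.
have e4 : expR (- (4 * y)) <= expR (- y) * expR (- y).
  by rewrite -expRD ler_expR; lra.
have pk0 : 0 <= normal_peak (2 * s) by exact: normal_peak_ge0.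
have ey : expR y * expR (- y) = 1 by rewrite -expRD subrr expR0.
apply: (@le_trans _ _ ((8 * s ^+ 2) ^+ k * (k`!%:R * expR y) *
   (2 * normal_peak (2 * s) * (expR (- y) * expR (- y))))).
  rewrite xy; apply: ler_pM => //.
  - by rewrite mulr_ge0// exprn_ge0.
  - by rewrite !mulr_ge0// expR_ge0.
  - by rewrite ler_wpM2l// exprn_ge0.
  - by rewrite ler_wpM2l// mulr_ge0.
rewrite le_eqVlt; apply/orP; left; apply/eqP.
rewrite /gaussian_moment_cst exprMn exprM.
transitivity (8 ^+ k * s ^+ 2 ^+ k * k`!%:R * (2 * normal_peak (2 * s)) *
  expR (- y) * (expR y * expR (- y))); first by ring.
by rewrite ey; ring.
Qed.

Lemma gaussian_moment_cst_ge0 k : 0 <= gaussian_moment_cst k.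
Proof. by rewrite /gaussian_moment_cst !mulr_ge0 ?exprn_ge0. Qed.

Lemma normal_moment_le (s : R) k : 0 < s ->
  (\int[normal_prob 0 s]_x (x ^+ (2 * k))%:E <=
    (gaussian_moment_cst k * s ^+ (2 * k))%:E)%E.
Proof.
move=> s0.
have mX : measurable_fun [set: R] (fun x : R => (x ^+ (2 * k))%:E).
  by apply/measurable_EFinP; exact: measurable_funX.
have mpdf s' : measurable_fun [set: R] (fun x : R => (normal_pdf 0 s' x)%:E).
  by apply/measurable_EFinP; exact: measurable_normal_pdf.
have X0 x : 0 <= x ^+ (2 * k) :> R by rewrite exprM exprn_ge0// sqr_ge0.
pose c : R := gaussian_moment_cst k * s ^+ (2 * k).
have c0 : 0 <= c by rewrite mulr_ge0 ?gaussian_moment_cst_ge0 ?exprn_ge0// ltW.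
rewrite ge0_integral_normal_prob//.
apply: (@le_trans _ _ (\int[mu]_x (c%:E * (normal_pdf 0 (2 * s) x)%:E))%E).
  apply: ge0_le_integral => //.
  - by move=> x _; rewrite mule_ge0 ?lee_fin// normal_pdf_ge0.
  - exact: (emeasurable_funM mX (mpdf s)).
  - exact: (emeasurable_funM (measurable_cst _) (mpdf (2 * s))).
  - by move=> x _; rewrite -!EFinM lee_fin; exact: exprn_normal_pdf_le.
rewrite ge0_integralZl//; last by move=> x _; rewrite lee_fin normal_pdf_ge0.
  by rewrite integral_normal_pdf mule1.
exact: (mpdf (2 * s)).
Qed.

End gaussian.

Section gaussian_variable.
Context {d : measure_display} {Om : measurableType d} {R : realType}.
Variables (P : probability Om R) (X : Om -> R) (s : R).
Hypothesis s0 : 0 < s.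
Hypothesis mX : measurable_fun setT X.
Hypothesis lawX : forall A, measurable A -> P (X @^-1` A) = normal_prob 0 s A.

Lemma ge0_integral_gaussian (phi : R -> R) : measurable_fun setT phi ->
  (forall x, 0 <= phi x) ->
  (\int[P]_w (phi (X w))%:E = \int[normal_prob 0 s]_x (phi x)%:E)%E.
Proof.
move=> mphi phi0; have mX' : measurable_fun setT (X : Om -> measurableTypeR R) := mX.
pose XM := @mfun_Sub _ _ Om (measurableTypeR R) X (mem_set mX').
transitivity (\int[distribution P XM]_x (phi x)%:E)%E.
  by rewrite ge0_integral_distribution//; apply/measurable_EFinP.
by apply: eq_measure_integral => A mA _; exact: lawX.
Qed.

Lemma gaussian_moment_le k :
  (\int[P]_w (X w ^+ (2 * k))%:E <=
   (gaussian_moment_cst k * s ^+ (2 * k))%:E)%E.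
Proof.
rewrite (@ge0_integral_gaussian (fun x => x ^+ (2 * k))).
- exact: normal_moment_le.
- exact: measurable_funX.
- by move=> x; rewrite exprM exprn_ge0// sqr_ge0.
Qed.

(** Symmetry of the law takes the place of a vanishing mean: applied to the positive part, it is an
    equality of nonnegative integrals. *)
Lemma ge0_integral_gaussianN (phi : R -> R) : measurable_fun setT phi ->
  (forall x, 0 <= phi x) ->
  (\int[P]_w (phi (- X w))%:E = \int[P]_w (phi (X w))%:E)%E.
Proof.
move=> mphi phi0.
have mNX : measurable_fun setT (fun w => - X w) by exact: measurableT_comp.
have mNX' : measurable_fun setT ((fun w => - X w) : Om -> measurableTypeR R) := mNX.
pose XM := @mfun_Sub _ _ Om (measurableTypeR R) _ (mem_set mNX').
rewrite ge0_integral_gaussian//.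
transitivity (\int[distribution P XM]_x (phi x)%:E)%E.
  by rewrite ge0_integral_distribution//; apply/measurable_EFinP.
apply: eq_measure_integral => A mA _.
transitivity (P (X @^-1` (-%R @^-1` A))) => //.
rewrite lawX; first by rewrite normal_probN// gt_eqF.
by rewrite -[X in measurable X]setTI; exact: oppr_measurable.
Qed.

End gaussian_variable.

(** * The past of a sequence of independent variables *)

Section independence.
Context {d : measure_display} {Om : measurableType d} {R : realType}.
Variables (P : probability Om R) (D : nat -> Om -> R).
Hypothesis mD : forall i, measurable_fun setT (D i).
Hypothesis indepD : forall n (A : nat -> set R), (forall i, measurable (A i)) ->
  P (\bigcap_(i in [set k | (k < n)%N]) (D i @^-1` A i)) =
  (\prod_(i < n) P (D i @^-1` A i))%E.

(** A pi-system; the sigma-algebra it generates is the past, that is, the information carried by the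
    first n variables. *)
Definition past_rect (n : nat) : set (set Om) :=
  [set E | exists2 A : nat -> set R, (forall i, measurable (A i)) &
    E = \bigcap_(i in [set k | (k < n)%N]) (D i @^-1` A i)].

Lemma measurable_preimage_D i (A : set R) : measurable A -> measurable (D i @^-1` A).
Proof. by move=> mA; rewrite -[X in measurable X]setTI; exact: mD. Qed.

Lemma past_rect_measurable n : past_rect n `<=` measurable.
Proof.
move=> _ [A mA ->]; apply: fin_bigcap_measurable => //.
by move=> i _; exact: measurable_preimage_D.
Qed.

Lemma past_measurable n : <<s past_rect n >> `<=` measurable.
Proof.
by apply: smallest_sub; [exact: sigma_algebra_measurable|exact: past_rect_measurable].
Qed.

Lemma past_rect_setI n : setI_closed (past_rect n).
Proof.
move=> _ _ [A mA ->] [B mB ->]; exists (fun i => A i `&` B i).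
  by move=> i; exact: measurableI.
by rewrite -bigcapI; apply: eq_bigcapr => i _; rewrite preimage_setI.
Qed.

(** With F the event on [D n], the measures E -> P(E and F) and E -> P(F) P(E) agree on the
    rectangles, a pi-system containing the whole space, hence on the past. *)
Lemma past_independent n E A : <<s past_rect n >> E -> measurable A ->
  P (E `&` (D n @^-1` A)) = (P E * P (D n @^-1` A))%E.
Proof.
move=> pE mA; have mF := measurable_preimage_D n A mA.
have PF : P (D n @^-1` A) = (fine (P (D n @^-1` A)))%:E.
  by rewrite fineK// fin_num_measure.
have PF0 : 0 <= fine (P (D n @^-1` A)) by rewrite fine_ge0.
pose k := NngNum PF0.
have gT : nat -> past_rect n setT.
  by move=> _; exists (fun=> setT) => //; apply/seteqP; split.
have gU : \bigcup_(_ in [set: nat]) [set: Om] = [set: Om] by rewrite bigcup_const.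
have rectE B : past_rect n B -> mrestr P mF B = mscale k P B.
  move=> [B0 mB ->] {B}; rewrite /mrestr /mscale /= -PF.
  (* With [A] as side number n, intersecting with the event on [D n] gives a rectangle in n + 1
     variables. *)
  pose B' i := if (i < n)%N then B0 i else A.
  have mB' i : measurable (B' i) by rewrite /B'; case: ifP.
  transitivity (P (\bigcap_(i in [set k0 | (k0 < n.+1)%N]) D i @^-1` B' i)).
    congr (P _); apply/seteqP; split => w.
      move=> [h1 h2] i /=; rewrite ltnS leq_eqVlt /B' => /predU1P[->|/[dup] iln ->].
        by rewrite ltnn.
      exact: h1.
    move=> h1; split.
      by move=> i /= iln; have := h1 i; rewrite /= /B' iln; apply; exact: ltnW.
    by have := h1 n; rewrite /= /B' ltnn; apply; exact: ltnSn.
  rewrite indepD// big_ord_recr/= {2}/B' ltnn muleC indepD//.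
  by congr (_ * _)%E; apply: eq_bigr => i _; rewrite /B' ltn_ord.
have goo : nat -> (mrestr P mF setT < +oo)%E.
  by move=> _; rewrite /mrestr setTI; exact: le_lt_trans (probability_le1 _ _) (ltry _).
have := @g_sigma_algebra_measure_unique _ _ _ (past_rect n)
  (@past_rect_measurable n) (fun=> setT) gT gU (mrestr P mF) (mscale k P)
  (@past_rect_setI n) rectE goo E pE.
by move=> h; rewrite [X in (_ * X)%E]PF muleC; exact: h.
Qed.

Definition past_fun n (W : Om -> R) :=
  forall A, measurable A -> <<s past_rect n >> (W @^-1` A).

Lemma past_fun_measurable n W : past_fun n W -> measurable_fun setT W.
Proof. by move=> pW _ A mA; rewrite setTI; apply: (@past_measurable n); exact: pW. Qed.

Lemma past_funP n W : past_fun n W <->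
  measurable_fun [set: g_sigma_algebraType (past_rect n)] (W : g_sigma_algebraType (past_rect n) -> R).
Proof.
split=> h; first by move=> _ A mA; rewrite setTI; exact: h.
by move=> A mA; have := h measurableT A mA; rewrite setTI.
Qed.

(** By independence the joint law of [W] and [D n] is the product of their laws, and Tonelli
    separates the two variables without any integrability assumption. *)
Lemma ge0_past_expectationM n (W : Om -> R) (phi : R -> R) :
  past_fun n W -> (forall w, 0 <= W w) ->
  measurable_fun setT phi -> (forall x, 0 <= phi x) ->
  (\int[P]_w (W w * phi (D n w))%:E =
   \int[P]_w (W w)%:E * \int[P]_w (phi (D n w))%:E)%E.
Proof.
move=> pW W0 mphi phi0.
have mW := @past_fun_measurable _ _ pW.
have mphiD : measurable_fun setT (fun w => (phi (D n w))%:E).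
  by apply/measurable_EFinP; exact: measurableT_comp.
pose WM : {mfun Om >-> R} := mfun_Sub (mem_set mW).
pose DM : {mfun Om >-> R} := mfun_Sub (mem_set (mD n)).
have mWD : measurable_fun setT (fun w => (W w, D n w)) by exact: measurable_fun_pair.
pose WDM : {mfun Om >-> (R * R)%type} := mfun_Sub (mem_set mWD).
(* The truncation changes nothing on the values of [W] and makes the integrand nonnegative on the
   whole plane, as Tonelli requires. *)
pose Fp (z : R * R) := ((Num.max z.1 0)%:E * (phi z.2)%:E)%E.
have mFp : measurable_fun setT Fp.
  apply: emeasurable_funM; apply/measurable_EFinP.
    by apply: measurable_maxr => //; exact: measurable_fst.
  by apply: measurableT_comp => //; exact: measurable_snd.
have Fp0 z : (0 <= Fp z)%E by rewrite mule_ge0// lee_fin// le_max lexx orbT.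
have E (Q : set (R * R)) : measurable Q ->
    (distribution P WM \x distribution P DM)%E Q = distribution P WDM Q.
  apply: product_measure_unique => A B mA mB.
  change (P ((W @^-1` A) `&` (D n @^-1` B)) = P (W @^-1` A) * P (D n @^-1` B))%E.
  by rewrite past_independent//; exact: pW.
transitivity (\int[distribution P WDM]_z Fp z)%E.
  rewrite ge0_integral_distribution//.
  by apply: eq_integral => w _; rewrite /= /Fp/= max_l// EFinM.
rewrite -(eq_measure_integral _ (fun A mA _ => E A mA)).
rewrite fubini_tonelli1// /fubini_F.
transitivity (\int[distribution P WM]_x ((Num.max x 0)%:E * \int[P]_w (phi (D n w))%:E))%E.
  apply: eq_integral => x _; rewrite /Fp/= ge0_integralZl//.
  - congr (_ * _)%E; rewrite ge0_integral_distribution//.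
    by apply/measurable_EFinP.
  - by apply/measurable_EFinP.
  - by move=> y _; rewrite lee_fin.
  - by rewrite lee_fin le_max lexx orbT.
rewrite ge0_integralZr//.
- congr (_ * _)%E; rewrite ge0_integral_distribution//.
  + by apply: eq_integral => w _; rewrite /= max_l.
  + by apply/measurable_EFinP; exact: measurable_maxr.
  + by move=> y; rewrite lee_fin le_max lexx orbT.
- by apply/measurable_EFinP; exact: measurable_maxr.
- by move=> y; rewrite lee_fin le_max lexx orbT.
- by apply: integral_ge0 => w _; rewrite lee_fin.
Qed.

Lemma past_fun_cst n (c : R) : past_fun n (fun=> c).
Proof. by apply/past_funP; exact: measurable_cst. Qed.

Lemma past_fun_comp n W (phi : R -> R) : measurable_fun setT phi ->
  past_fun n W -> past_fun n (fun w => phi (W w)).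
Proof.
by move=> mphi pW A mA; apply: (pW (phi @^-1` A)); rewrite -[X in measurable X]setTI; exact: mphi.
Qed.

Lemma past_funD n W1 W2 : past_fun n W1 -> past_fun n W2 ->
  past_fun n (fun w => W1 w + W2 w).
Proof. by move=> /past_funP h1 /past_funP h2; apply/past_funP; exact: measurable_funD. Qed.

Lemma past_funM n W1 W2 : past_fun n W1 -> past_fun n W2 ->
  past_fun n (fun w => W1 w * W2 w).
Proof. by move=> /past_funP h1 /past_funP h2; apply/past_funP; exact: measurable_funM. Qed.

Lemma past_fun_max n W1 W2 : past_fun n W1 -> past_fun n W2 ->
  past_fun n (fun w => Num.max (W1 w) (W2 w)).
Proof. by move=> /past_funP h1 /past_funP h2; apply/past_funP; exact: measurable_maxr. Qed.

Lemma past_funX n W k : past_fun n W -> past_fun n (fun w => W w ^+ k).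
Proof. by move=> /past_funP h1; apply/past_funP; exact: measurable_funX. Qed.

Lemma past_fun_sum n m (W : nat -> Om -> R) : (forall j, (j < m)%N -> past_fun n (W j)) ->
  past_fun n (fun w => \sum_(j < m) W j w).
Proof.
elim: m => [|m IH] pW.
  rewrite (_ : (fun _ => _) = (fun=> 0)); first exact: past_fun_cst.
  by apply/funext => w; rewrite big_ord0.
rewrite (_ : (fun _ => _) = (fun w => (\sum_(j < m) W j w) + W m w)).
  by apply: past_funD; [apply: IH => j jm; apply: pW; exact: ltnW|exact: pW].
by apply/funext => w; rewrite big_ord_recr.
Qed.

Lemma past_fun_D n i : (i < n)%N -> past_fun n (D i).
Proof.
move=> iln A mA; apply: sub_sigma_algebra.
exists (fun j => if j == i then A else setT) => [j|]; first by case: ifP.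
apply/seteqP; split => w /=.
  by move=> Aw j _ /=; case: eqP => [->|].
by move=> /(_ i iln); rewrite /= eqxx.
Qed.

(* The sublevel sets of X' are preimages by X of unions of open balls. *)
Lemma past_fun_lipschitz n (X X' : Om -> R) (K : R) : 0 < K ->
  (forall w w', `|X' w - X' w'| <= K * `|X w - X w'|) ->
  past_fun n X -> past_fun n X'.
Proof.
move=> K0 lip pX; apply/past_funP.
apply: (measurability _ (RGenInftyO.measurableE R)).
move=> _ [_ [c ->] <-]; rewrite setTI.
pose U := \bigcup_(w in [set w | X' w < c]) ball (X w) ((c - X' w) / K).
rewrite (_ : _ @^-1` _ = X @^-1` U); first apply: pX.
  by apply: open_measurable; apply: bigcup_open => w _; exact: ball_open.
apply/seteqP; split => w /=; rewrite in_itv/=.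
  move=> wc; exists w => //; apply: ballxx.
  by rewrite divr_gt0// subr_gt0.
move=> [w' /= w'c]; rewrite /ball/= ltr_pdivlMr// => h.
have := lip w w'; rewrite [X in _ <= K * X]distrC => lw.
have := ler_norm (X' w - X' w'); lra.
Qed.

End independence.

(** Each summand is a nonnegative function of x times one of y, so the expectation of the positive
    part of [W * D n] factorises by independence. *)
Lemma maxr0M {R : realType} (x y : R) :
  Num.max (x * y) 0 = Num.max x 0 * Num.max y 0 + Num.max (- x) 0 * Num.max (- y) 0.
Proof.
have P (z : R) : 0 <= z -> Num.max z 0 = z /\ Num.max (- z) 0 = 0.
  by move=> z0; split; [exact: max_l|apply: max_r; rewrite oppr_le0].
have N (z : R) : z <= 0 -> Num.max z 0 = 0 /\ Num.max (- z) 0 = - z.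
  by move=> z0; split; [exact: max_r|apply: max_l; rewrite oppr_ge0].
case/orP: (le_total 0 x) => x0; case/orP: (le_total 0 y) => y0.
- have [-> ->] := P _ x0; have [-> ->] := P _ y0.
  by have [-> _] := P _ (mulr_ge0 x0 y0); ring.
- have [-> ->] := P _ x0; have [-> ->] := N _ y0.
  by have [-> _] := N _ (mulr_ge0_le0 x0 y0); ring.
- have [-> ->] := N _ x0; have [-> ->] := P _ y0.
  by have [-> _] := N _ (mulr_le0_ge0 x0 y0); ring.
- have [-> ->] := N _ x0; have [-> ->] := N _ y0.
  by have [-> _] := P _ (mulr_le0 x0 y0); ring.
Qed.

Lemma maxr0B {R : realType} (x : R) : Num.max x 0 - Num.max (- x) 0 = x.
Proof.
case/orP: (le_total 0 x) => x0.
  by rewrite (max_l x0) max_r ?subr0// oppr_le0.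
by rewrite (max_r x0) max_l ?sub0r ?opprK// oppr_ge0.
Qed.

(** One step of the even moment, with s and b from the past and y the next increment. Besides the
    linear term only y^2 and y^(2k) occur, of mean O(h); the lower power of s is absorbed by
    |s|^(2k-2) <= 1 + s^(2k), which makes the recursion close on a single moment. *)
Lemma exprn_perturb_le {R : realType} (s y b L : R) k : (0 < k)%N -> `|b| <= L ->
  (s + b * y) ^+ (2 * k) <= s ^+ (2 * k) + (2 * k)%:R * s ^+ (2 * k).-1 * b * y
    + ((2 * k) ^ 2)%:R * 2 ^+ (2 * k) *
      (L ^+ 2 * ((1 + s ^+ (2 * k)) * y ^+ 2) + L ^+ (2 * k) * y ^+ (2 * k)).
Proof.
case: k => // k _ bL; have L0 : 0 <= L by exact: le_trans (normr_ge0 _) bL.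
have ek : ~~ odd (2 * k.+1) by rewrite oddM.
have := exprDn_taylor1 s (b * y) (2 * k.+1).
move=> /(le_trans (ler_norm _)); rewrite mulnS add2n /= in ek *.
set j := (2 * k)%N in ek *; set q := j.+2 in ek *.
set Z := (_ * _ ^+ j) => tay.
suff HZ : Z <= (q ^ 2)%:R * 2 ^+ q *
    (L ^+ 2 * ((1 + s ^+ q) * y ^+ 2) + L ^+ q * y ^+ q).
  move: tay; set u := _ * s ^+ j.+1 * (b * y); set u' := _ * s ^+ j.+1 * b * y.
  have -> : u = u' by rewrite /u /u' !mulrA.
  move: HZ; set A := _ * (_ + _ * y ^+ q); lra.
rewrite /Z -!(mulrA (q ^ 2)%:R) ler_wpM2l ?ler0n//.
have eveny (z : R) : z ^+ q = `|z| ^+ q.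
  by rewrite -normrX ger0_norm// exprn_even_ge0.
have by2 : (b * y) ^+ 2 <= L ^+ 2 * y ^+ 2.
  rewrite exprMn ler_wpM2r ?sqr_ge0// -[b ^+ 2]real_normK ?num_real//.
  by rewrite lerXn2r ?nnegrE.
have byq : `|b * y| ^+ q <= L ^+ q * y ^+ q.
  rewrite [y ^+ q]eveny normrM exprMn ler_wpM2r ?exprn_ge0//.
  by rewrite lerXn2r ?nnegrE.
have sj : `|s| ^+ j <= 1 + s ^+ q by apply: exprn_le1D_even => //; rewrite /q; lia.
have sj0 : 0 <= `|s| ^+ j by rewrite exprn_ge0.
have x20 : 0 <= (b * y) ^+ 2 by rewrite sqr_ge0.
have Lyq : 0 <= L ^+ q * y ^+ q by rewrite (le_trans _ byq)// exprn_ge0.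
apply: (@le_trans _ _ ((b * y) ^+ 2 * (2 ^+ j * (`|s| ^+ j + `|b * y| ^+ j)))).
  by rewrite ler_wpM2l// exprDn_le_cst.
have -> : (b * y) ^+ 2 * (2 ^+ j * (`|s| ^+ j + `|b * y| ^+ j)) =
    2 ^+ j * ((b * y) ^+ 2 * `|s| ^+ j + `|b * y| ^+ q).
  have -> : `|b * y| ^+ q = (b * y) ^+ 2 * `|b * y| ^+ j.
    by rewrite -[in RHS](real_normK (num_real (b * y))) -exprD.
  by ring.
apply: (@le_trans _ _ (2 ^+ j * (L ^+ 2 * ((1 + s ^+ q) * y ^+ 2) + L ^+ q * y ^+ q))).
  rewrite ler_wpM2l ?exprn_ge0// lerD//.
  apply: (@le_trans _ _ (L ^+ 2 * y ^+ 2 * (1 + s ^+ q))); first exact: ler_pM.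
  by rewrite le_eqVlt; apply/orP; left; apply/eqP; ring.
rewrite ler_wpM2r//.
  apply: addr_ge0 => //; apply: (mulr_ge0 (sqr_ge0 _)); apply: (mulr_ge0 _ (sqr_ge0 _)).
  exact: le_trans sj0 sj.
by rewrite ler_weXn2l ?ler1n// /q -addn2 leq_addr.
Qed.

Section ge0_real_integral.
Context {d : measure_display} {Om : measurableType d} {R : realType}.
Variable P : {measure set Om -> \bar R}.
Implicit Types f g : Om -> R.

Lemma ge0_integralD_real f g : (forall w, 0 <= f w) -> (forall w, 0 <= g w) ->
  measurable_fun setT f -> measurable_fun setT g ->
  (\int[P]_w (f w + g w)%:E = \int[P]_w (f w)%:E + \int[P]_w (g w)%:E)%E.
Proof.
move=> f0 g0 mf mg; rewrite -ge0_integralD//; try exact/measurable_EFinP.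
  by move=> w _; rewrite lee_fin.
by move=> w _; rewrite lee_fin.
Qed.

Lemma ge0_integralZl_real (c : R) f : 0 <= c -> (forall w, 0 <= f w) ->
  measurable_fun setT f ->
  (\int[P]_w (c * f w)%:E = c%:E * \int[P]_w (f w)%:E)%E.
Proof.
move=> c0 f0 mf; rewrite -ge0_integralZl//; first exact/measurable_EFinP.
by move=> w _; rewrite lee_fin.
Qed.

Lemma ge0_integral_sum_real (f : nat -> Om -> R) n : (forall i w, 0 <= f i w) ->
  (forall i, measurable_fun setT (f i)) ->
  (\int[P]_w (\sum_(i < n) f i w)%:E = \sum_(i < n) \int[P]_w (f i w)%:E)%E.
Proof.
move=> f0 mf; rewrite -ge0_integral_sum//.
- by apply: eq_integral => w _; rewrite sumEFin.
- by move=> i; exact/measurable_EFinP.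
- by move=> i w _; rewrite lee_fin.
Qed.

Lemma ge0_le_integral_real f g : (forall w, 0 <= f w) ->
  measurable_fun setT f -> measurable_fun setT g -> (forall w, f w <= g w) ->
  (\int[P]_w (f w)%:E <= \int[P]_w (g w)%:E)%E.
Proof.
move=> f0 mf mg fg; apply: ge0_le_integral => //; try exact/measurable_EFinP.
  by move=> w _; rewrite lee_fin.
by move=> w _; rewrite lee_fin.
Qed.

End ge0_real_integral.

(** * Moments and maximum of a transform of Gaussian increments *)

Section martingale_transform.
Context {d : measure_display} {Om : measurableType d} {R : realType}.
Variables (P : probability Om R) (D : nat -> Om -> R) (h : R).
Hypothesis h0 : 0 < h.
Hypothesis mD : forall i, measurable_fun setT (D i).
Hypothesis indepD : forall n (A : nat -> set R), (forall i, measurable (A i)) ->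
  P (\bigcap_(i in [set k | (k < n)%N]) (D i @^-1` A i)) =
  (\prod_(i < n) P (D i @^-1` A i))%E.
Hypothesis lawD : forall i A, measurable A ->
  P (D i @^-1` A) = normal_prob 0 (Num.sqrt h) A.

Let sh0 : 0 < Num.sqrt h. Proof. by rewrite sqrtr_gt0. Qed.

Lemma increment_moment_le i k :
  (\int[P]_w (D i w ^+ (2 * k))%:E <= (gaussian_moment_cst k * h ^+ k)%:E)%E.
Proof.
have := gaussian_moment_le P (D i) _ sh0 (mD i) (lawD i) k.
by rewrite [in X in (_ <= X)%E]exprM sqr_sqrtr// ltW.
Qed.

(* Positive and negative parts are kept apart so that only nonnegative
   integrals occur. *)
Lemma past_centered n W : past_fun D n W -> (\int[P]_w `|W w|%:E < +oo)%E ->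
  (\int[P]_w (Num.max (W w * D n w) 0)%:E =
   \int[P]_w (Num.max (- (W w * D n w)) 0)%:E)%E /\
  (\int[P]_w (Num.max (W w * D n w) 0)%:E < +oo)%E.
Proof.
move=> pW Woo.
have pWp : past_fun D n (fun w => Num.max (W w) 0).
  by apply: past_fun_max => //; exact: past_fun_cst.
have pWm : past_fun D n (fun w => Num.max (- W w) 0).
  apply: past_fun_max; last exact: past_fun_cst.
  exact: (past_fun_comp _ _ W -%R).
have mW : measurable_fun setT W := past_fun_measurable D mD n W pW.
have ge0m (x : R) : 0 <= Num.max x 0 by rewrite le_max lexx orbT.
have mp : measurable_fun setT (fun x : R => Num.max x 0).
  by apply: measurable_maxr => //; exact: measurable_id.
have mm : measurable_fun setT (fun x : R => Num.max (- x) 0).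
  by apply: measurable_maxr => //; exact: measurable_id.
pose Dp := (\int[P]_w (Num.max (D n w) 0)%:E)%E.
have DmE : (\int[P]_w (Num.max (- D n w) 0)%:E = Dp)%E.
  exact: (ge0_integral_gaussianN P (D n) _ sh0 (mD n) (lawD n) (fun x => Num.max x 0)).
have mDp : measurable_fun setT (fun w => (Num.max (D n w) 0)%:E).
  by apply/measurable_EFinP; apply: measurable_maxr.
have mDm : measurable_fun setT (fun w => (Num.max (- D n w) 0)%:E).
  by apply/measurable_EFinP; apply: measurable_maxr => //; exact: measurableT_comp.
have mWp : measurable_fun setT (fun w => (Num.max (W w) 0)%:E).
  by apply/measurable_EFinP; apply: measurable_maxr.
have mWm : measurable_fun setT (fun w => (Num.max (- W w) 0)%:E).
  by apply/measurable_EFinP; apply: measurable_maxr => //; exact: measurableT_comp.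
have E1 : (\int[P]_w (Num.max (W w * D n w) 0)%:E =
   \int[P]_w (Num.max (W w) 0)%:E * Dp + \int[P]_w (Num.max (- W w) 0)%:E * Dp)%E.
  rewrite -[X in (_ + _ * X)%E]DmE.
  rewrite -(ge0_past_expectationM P D mD indepD n _ (fun x => Num.max x 0))//.
  rewrite -(ge0_past_expectationM P D mD indepD n _ (fun x => Num.max (- x) 0))//.
  rewrite -ge0_integralD//.
  - by apply: eq_integral => w _; rewrite -EFinD maxr0M.
  - by move=> w _; rewrite lee_fin mulr_ge0.
  - by apply/measurable_EFinP; apply: measurable_funM; apply/measurable_EFinP.
  - by move=> w _; rewrite lee_fin mulr_ge0.
  - by apply/measurable_EFinP; apply: measurable_funM; apply/measurable_EFinP.
have E2 : (\int[P]_w (Num.max (- (W w * D n w)) 0)%:E =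
   \int[P]_w (Num.max (W w) 0)%:E * Dp + \int[P]_w (Num.max (- W w) 0)%:E * Dp)%E.
  rewrite -[X in (_ * X + _)%E]DmE.
  rewrite -(ge0_past_expectationM P D mD indepD n _ (fun x => Num.max (- x) 0))//.
  rewrite -(ge0_past_expectationM P D mD indepD n _ (fun x => Num.max x 0))//.
  rewrite -ge0_integralD//.
  - by apply: eq_integral => w _; rewrite -EFinD -mulrN maxr0M opprK.
  - by move=> w _; rewrite lee_fin mulr_ge0.
  - by apply/measurable_EFinP; apply: measurable_funM; apply/measurable_EFinP.
  - by move=> w _; rewrite lee_fin mulr_ge0.
  - by apply/measurable_EFinP; apply: measurable_funM; apply/measurable_EFinP.
split; first by rewrite E1 E2.
have Dpoo : (Dp < +oo)%E.
  apply: (@le_lt_trans _ _ (\int[P]_w (1 + (D n w ^+ (2 * 1))%:E))%E).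
    apply: ge0_le_integral => //.
    - by move=> w _; rewrite lee_fin.
    - apply: emeasurable_funD => //; apply/measurable_EFinP.
      exact: measurable_funX.
    - move=> w _; rewrite -EFinD lee_fin muln1 ge_max; apply/andP; split; nra.
  rewrite ge0_integralD//.
  - rewrite integral_cst//= probability_setT mule1.
    by rewrite lte_add_pinfty ?ltry// (le_lt_trans (increment_moment_le n 1))// ltry.
  - by move=> w _; rewrite lee_fin muln1 sqr_ge0.
  - by apply/measurable_EFinP; exact: measurable_funX.
have Woo' (V : Om -> R) : (forall w, 0 <= V w <= `|W w|) -> measurable_fun setT (EFin \o V) ->
    (\int[P]_w (V w)%:E * Dp < +oo)%E.
  move=> VW mV; apply: lte_mul_pinfty => //.
  - by apply: integral_ge0 => w _; rewrite lee_fin; case/andP: (VW w).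
  - rewrite ge0_fin_numE.
      apply: le_lt_trans Woo; apply: ge0_le_integral => //.
      - by move=> w _; rewrite lee_fin; case/andP: (VW w).
      - by apply/measurable_EFinP; apply: measurableT_comp.
      - by move=> w _; rewrite lee_fin; case/andP: (VW w).
    by apply: integral_ge0 => w _; rewrite lee_fin; case/andP: (VW w).
rewrite E1 lte_add_pinfty//; apply: Woo' => // w.
  by rewrite ge0m ge_max ler_norm normr_ge0.
by rewrite ge0m ge_max normr_ge0 andbT -normrN ler_norm.
Qed.

Variables (a : nat -> Om -> R) (L T : R).
Hypothesis L0 : 0 <= L.
Hypothesis hT : h <= T.
Hypothesis pa : forall i n, (i <= n)%N -> past_fun D n (a i).
Hypothesis aL : forall i w, `|a i w| <= L.

Definition transform (i : nat) (w : Om) : R := \sum_(j < i) a j w * D j w.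
Local Notation S := transform.

Lemma past_fun_transform i n : (i <= n)%N -> past_fun D n (S i).
Proof.
move=> iln; apply: (past_fun_sum D n i (fun j w => a j w * D j w)) => j ji.
apply: past_funM; first by apply: pa; rewrite (leq_trans (ltnW ji)).
by apply: past_fun_D; rewrite (leq_trans ji).
Qed.

Lemma measurable_transform i : measurable_fun setT (S i).
Proof. exact: (past_fun_measurable D mD i _ (past_fun_transform i i (leqnn _))). Qed.

Lemma transformS i w : S i.+1 w = S i w + a i w * D i w.
Proof. by rewrite /S big_ord_recr. Qed.

(** The remainder of [exprn_perturb_le] with the moments of an increment inserted; h^k is traded for
    h T^(k-1), which leaves a single factor h, the length of the step. *)
Definition transform_rate (k : nat) : R :=
  ((2 * k) ^ 2)%:R * 2 ^+ (2 * k) *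
  (L ^+ 2 * gaussian_moment_cst 1 + L ^+ (2 * k) * gaussian_moment_cst k * T ^+ k.-1).

Lemma transform_rate_ge0 k : 0 <= transform_rate k.
Proof.
have T0 : 0 <= T by rewrite (le_trans (ltW h0)).
by rewrite mulr_ge0 ?addr_ge0 ?mulr_ge0 ?exprn_ge0 ?gaussian_moment_cst_ge0.
Qed.

Let measurable_Sq i k : measurable_fun setT (fun w => (S i w ^+ k)%:E).
Proof. by apply/measurable_EFinP; apply: measurable_funX; exact: measurable_transform. Qed.

Let even_ge0 (x : R) k : 0 <= x ^+ (2 * k).
Proof. by rewrite exprM exprn_ge0// sqr_ge0. Qed.

(** In the expansion of the next power, the term linear in [D i] has mean zero because its
    coefficient [W] belongs to the past, and the remainder has mean O(h). *)
Lemma transform_moment_step k i (v : R) : (0 < k)%N ->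
  (\int[P]_w (S i w ^+ (2 * k))%:E <= v%:E)%E ->
  (\int[P]_w (S i.+1 w ^+ (2 * k))%:E <= (v + transform_rate k * h * (1 + v))%:E)%E.
Proof.
move=> k0 Sv.
have v0 : 0 <= v.
  by rewrite -lee_fin (le_trans _ Sv)// integral_ge0// => w _; rewrite lee_fin.
pose W w := (2 * k)%:R * S i w ^+ (2 * k).-1 * a i w.
have pS : past_fun D i (S i) by exact: past_fun_transform.
have pW : past_fun D i W.
  by apply: past_funM; [apply: past_funM; [exact: past_fun_cst|exact: past_funX]|exact: pa].
have mW : measurable_fun setT W := past_fun_measurable D mD i W pW.
have int1S : (\int[P]_w (1 + S i w ^+ (2 * k))%:E <= (1 + v)%:E)%E.
  rewrite (eq_integral (fun w => 1%:E + (S i w ^+ (2 * k))%:E)%E); last first.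
    by move=> w _; rewrite EFinD.
  rewrite ge0_integralD//; last by move=> w _; rewrite lee_fin.
  by rewrite integral_cst//= probability_setT mule1 EFinD leeD2l.
have Woo : (\int[P]_w `|W w|%:E < +oo)%E.
  apply: (@le_lt_trans _ _ (\int[P]_w (((2 * k)%:R * L)%:E * (1 + S i w ^+ (2 * k))%:E))%E).
    apply: ge0_le_integral => //.
    - by apply/measurable_EFinP; exact: measurableT_comp.
    - apply/measurable_EFinP; apply: measurable_funM => //.
      by apply: measurable_funD => //; exact/measurable_EFinP/measurable_Sq.
    - move=> w _; rewrite -EFinM lee_fin /W !normrM normr_nat normrX -!mulrA.
      rewrite ler_wpM2l ?ler0n// mulrC; apply: ler_pM => //.
      by apply: exprn_le1D_even; rewrite ?leq_pred// oddM.
  rewrite ge0_integralZl//.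
  - by rewrite (le_lt_trans (lee_wpmul2l _ int1S)) ?lee_fin ?mulr_ge0// -EFinM ltry.
  - by apply/measurable_EFinP; apply: measurable_funD => //; exact/measurable_EFinP/measurable_Sq.
  - by move=> w _; rewrite lee_fin addr_ge0.
  - by rewrite lee_fin mulr_ge0.
have [WE WDoo] := past_centered i W pW Woo.
pose c : R := ((2 * k) ^ 2)%:R * 2 ^+ (2 * k).
have c0 : 0 <= c by rewrite mulr_ge0 ?exprn_ge0.
pose rest w := c * (L ^+ 2 * ((1 + S i w ^+ (2 * k)) * D i w ^+ 2)
   + L ^+ (2 * k) * D i w ^+ (2 * k)).
have S10 w : 0 <= 1 + S i w ^+ (2 * k) := addr_ge0 ler01 (even_ge0 _ k).
have r10 w : 0 <= L ^+ 2 * ((1 + S i w ^+ (2 * k)) * D i w ^+ 2) :=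
  mulr_ge0 (sqr_ge0 L) (mulr_ge0 (S10 w) (sqr_ge0 _)).
have r20 w : 0 <= L ^+ (2 * k) * D i w ^+ (2 * k) :=
  mulr_ge0 (even_ge0 L k) (even_ge0 _ k).
have rest0 w : 0 <= rest w := mulr_ge0 c0 (addr_ge0 (r10 w) (r20 w)).
have mSk : measurable_fun setT (fun w => S i w ^+ (2 * k)).
  by apply: measurable_funX; exact: measurable_transform.
have m1S : measurable_fun setT (fun w => 1 + S i w ^+ (2 * k)).
  exact: measurable_funD.
have mDk j : measurable_fun setT (fun w => D i w ^+ j) by exact: measurable_funX.
have mr1 : measurable_fun setT (fun w => (L ^+ 2 * ((1 + S i w ^+ (2 * k)) * D i w ^+ 2))%:E).
  by apply/measurable_EFinP; apply: measurable_funM => //; exact: measurable_funM.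
have mr2 : measurable_fun setT (fun w => (L ^+ (2 * k) * D i w ^+ (2 * k))%:E).
  by apply/measurable_EFinP; exact: measurable_funM.
have mrest : measurable_fun setT (EFin \o rest).
  apply/measurable_EFinP; apply: measurable_funM => //.
  by apply: measurable_funD; exact/measurable_EFinP.
have intrest : (\int[P]_w (rest w)%:E <= (transform_rate k * h * (1 + v))%:E)%E.
  rewrite (eq_integral (fun w => c%:E * ((L ^+ 2 * ((1 + S i w ^+ (2 * k)) * D i w ^+ 2))%:E
     + (L ^+ (2 * k) * D i w ^+ (2 * k))%:E))%E); last first.
    by move=> w _; rewrite -EFinD -EFinM.
  rewrite ge0_integralZl//; [|by apply: emeasurable_funD|]; last first.
    by move=> w _; rewrite adde_ge0 ?lee_fin.
  rewrite ge0_integralD//; last 2 first.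
    by move=> w _; rewrite lee_fin.
    by move=> w _; rewrite lee_fin.
  have I1 : (\int[P]_w (L ^+ 2 * ((1 + S i w ^+ (2 * k)) * D i w ^+ 2))%:E <=
      (L ^+ 2 * ((1 + v) * (gaussian_moment_cst 1 * h)))%:E)%E.
    under eq_integral do rewrite EFinM.
    rewrite ge0_integralZl//; last 3 first.
      by apply/measurable_EFinP; exact: measurable_funM.
      by move=> w _; rewrite lee_fin (mulr_ge0 (S10 w) (sqr_ge0 _)).
      by rewrite lee_fin sqr_ge0.
    rewrite (ge0_past_expectationM P D mD indepD i (fun w => 1 + S i w ^+ (2 * k))
      (fun x => x ^+ 2)); last 4 first.
      by apply: past_funD; [exact: past_fun_cst|exact: past_funX].
      exact: S10.
      exact: measurable_funX.
      by move=> x; exact: sqr_ge0.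
    rewrite !EFinM lee_wpmul2l ?lee_fin ?sqr_ge0//.
    have := increment_moment_le i 1; rewrite muln1 expr1 => D2.
    apply: lee_pmul => //; apply: integral_ge0 => w _; rewrite lee_fin ?sqr_ge0//.
  have I2 : (\int[P]_w (L ^+ (2 * k) * D i w ^+ (2 * k))%:E <=
      (L ^+ (2 * k) * (gaussian_moment_cst k * T ^+ k.-1 * h * (1 + v)))%:E)%E.
    under eq_integral do rewrite EFinM.
    rewrite ge0_integralZl//; last 3 first.
      exact/measurable_EFinP.
      by move=> w _; rewrite lee_fin.
      by rewrite lee_fin.
    rewrite EFinM lee_wpmul2l ?lee_fin//.
    apply: le_trans (increment_moment_le i k) _; rewrite lee_fin.
    have := gaussian_moment_cst_ge0 (R := R) k; move: (gaussian_moment_cst k) => G G0.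
    rewrite -!(mulrA G) ler_wpM2l//.
    case: (k) k0 => // k' _; rewrite exprSr /= -mulrA.
    have hTk : h ^+ k' <= T ^+ k'.
      by rewrite lerXn2r ?nnegrE// ?(le_trans (ltW h0))// ltW.
    have hk0 : 0 <= h ^+ k' by rewrite exprn_ge0// ltW.
    apply: ler_pM => //; first exact: ltW.
    by rewrite ler_peMr ?lerDl// ltW.
  apply: le_trans (lee_wpmul2l _ (leeD I1 I2)) _; first by rewrite lee_fin.
  rewrite -EFinD -EFinM lee_fin /transform_rate -/c le_eqVlt; apply/orP; left.
  by apply/eqP; ring.
have mp : measurable_fun setT (fun w => (Num.max (W w * D i w) 0)%:E).
  by apply/measurable_EFinP; apply: measurable_maxr => //; exact: measurable_funM.
have mm : measurable_fun setT (fun w => (Num.max (- (W w * D i w)) 0)%:E).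
  apply/measurable_EFinP; apply: measurable_maxr => //.
  by apply: measurableT_comp => //; exact: measurable_funM.
have ge0m (x : R) : 0 <= Num.max x 0 by rewrite le_max lexx orbT.
(* The negative part of the linear term stands on the left and its positive part on the right; their
   integrals are equal and finite, hence cancel. *)
have key : (\int[P]_w (S i.+1 w ^+ (2 * k))%:E + \int[P]_w (Num.max (- (W w * D i w)) 0)%:E <=
   \int[P]_w (S i w ^+ (2 * k))%:E + \int[P]_w (Num.max (W w * D i w) 0)%:E
   + \int[P]_w (rest w)%:E)%E.
  have mSk' : measurable_fun setT (fun w => S i.+1 w ^+ (2 * k)).
    by apply: measurable_funX; exact: measurable_transform.
  move/measurable_EFinP in mp; move/measurable_EFinP in mm.
  move/measurable_EFinP in mrest.
  have mSp := measurable_funD mSk mp; have mSm := measurable_funD mSk' mm.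
  rewrite -ge0_integralD_real// -ge0_integralD_real// -ge0_integralD_real//; last first.
    by move=> w; rewrite addr_ge0.
  apply: ge0_le_integral_real => //.
  - by move=> w; rewrite addr_ge0.
  - exact: measurable_funD.
  - move=> w; rewrite transformS.
    have := exprn_perturb_le (S i w) (D i w) (a i w) L k k0 (aL i w).
    rewrite -/(rest w) -/(W w); have := maxr0B (W w * D i w).
    set A := (_ + _) ^+ _; set p := Num.max _ _; set m := Num.max _ _; lra.
rewrite WE -addeAC leeD2rE in key; last first.
  by rewrite ge0_fin_numE -?WE// integral_ge0// => w _; rewrite lee_fin.
by apply: le_trans key _; rewrite EFinD leeD.
Qed.

Lemma transform_moment k N : (0 < k)%N ->
  (\int[P]_w (S N w ^+ (2 * k))%:E <= (expR (transform_rate k * (h *+ N)))%:E)%E.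
Proof.
move=> k0.
pose v := fix v i := if i is j.+1 then v j + transform_rate k * h * (1 + v j) else 0.
have Sv i : (\int[P]_w (S i w ^+ (2 * k))%:E <= (v i)%:E)%E.
  elim: i => [|i IH]; last exact: transform_moment_step.
  rewrite (eq_integral (cst 0%E)) ?integral0// => w _.
  by rewrite /S big_ord0 expr0n muln_eq0/= eqn0Ngt k0.
apply: le_trans (Sv N) _; rewrite lee_fin.
apply: (@linear_recurrence_le _ v) => //; last exact: ltW.
exact: transform_rate_ge0.
Qed.

(** For even n this is the n-th power of the maximum of |S|. The recursive form makes the hypotheses
    of [doob_trajectorial] hold by conversion. *)
Fixpoint running_max (n i : nat) (w : Om) : R :=
  if i is j.+1 then Num.max (running_max n j w) (S i w ^+ n) else S 0 w ^+ n.

Lemma running_max_ge n i N w : (i <= N)%N -> S i w ^+ n <= running_max n N w.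
Proof.
elim: N => [|N IH]; first by rewrite leqn0 => /eqP ->.
by rewrite leq_eqVlt ltnS le_max => /predU1P[->|/IH ->//]; rewrite lexx orbT.
Qed.

Lemma past_fun_running_max n i N : (i <= N)%N -> past_fun D N (running_max n i).
Proof.
elim: i => [|i IH] iN; first by apply: past_funX; exact: past_fun_transform.
apply: past_fun_max; first by apply: IH; exact: ltnW.
by apply: past_funX; exact: past_fun_transform.
Qed.

Lemma measurable_running_max n i : measurable_fun setT (running_max n i).
Proof. exact: (past_fun_measurable D mD i _ (past_fun_running_max n i i (leqnn _))). Qed.

Lemma running_max_ge0 n i w : ~~ odd n -> 0 <= running_max n i w.
Proof.
by move=> en; apply: le_trans (running_max_ge n i i w (leqnn _)); rewrite exprn_even_ge0.
Qed.

(** A bound that deteriorates with i, used for finiteness only: it supplies the integrability behind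
    the cancellation in [transform_maximal]. *)
Lemma running_max_sqr_le n i w : ~~ odd n ->
  running_max n i w ^+ 2 <= \sum_(j < i.+1) S j w ^+ (2 * n).
Proof.
move=> en; elim: i => [|i IH].
  by rewrite big_ord_recr big_ord0 /= add0r mulnC exprM.
rewrite big_ord_recr/= (_ : S i.+1 w ^+ (2 * n) = (S i.+1 w ^+ n) ^+ 2); last first.
  by rewrite mulnC exprM.
have s0 : 0 <= \sum_(j < i.+1) S j w ^+ (2 * n) by rewrite sumr_ge0.
have := sqr_ge0 (S i.+1 w ^+ n).
case: (leP (running_max n i w) (S i.+1 w ^+ n)) => _ ?; first by rewrite lerDr.
by apply: le_trans IH _; rewrite lerDl.
Qed.

Lemma running_max_sqr_lty n i : (0 < n)%N -> ~~ odd n ->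
  (\int[P]_w (running_max n i w ^+ 2)%:E < +oo)%E.
Proof.
move=> n0 en.
apply: (@le_lt_trans _ _ (\int[P]_w (\sum_(j < i.+1) S j w ^+ (2 * n))%:E)%E).
  apply: ge0_le_integral_real => [w|||w]; rewrite ?sqr_ge0 ?running_max_sqr_le//.
    by apply: measurable_funX; exact: measurable_running_max.
  by apply: measurable_sum => j; apply: measurable_funX; exact: measurable_transform.
rewrite (ge0_integral_sum_real _ (fun j w => S j w ^+ (2 * n)))//; last first.
  by move=> j; apply: measurable_funX; exact: measurable_transform.
apply: lte_sum_pinfty => j _.
by apply: le_lt_trans (transform_moment n j n0) _; rewrite ltry.
Qed.

Lemma transform_maximal n N : (0 < n)%N -> ~~ odd n ->
  (\int[P]_w (running_max n N w ^+ 2)%:E <=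
   (4 * expR (transform_rate n * (h *+ N)))%:E)%E.
Proof.
move=> n0 en.
pose W k w := running_max n k w * (n%:R * S k w ^+ n.-1 * a k w).
have pW k : past_fun D k (W k).
  apply: past_funM; first exact: past_fun_running_max.
  apply: past_funM; last exact: pa.
  apply: past_funM; first exact: past_fun_cst.
  by apply: past_funX; exact: past_fun_transform.
have mW k : measurable_fun setT (W k) := past_fun_measurable D mD k _ (pW k).
have m0 k w := running_max_ge0 n k w en.
have mm2 k : measurable_fun setT (fun w => running_max n k w ^+ 2).
  by apply: measurable_funX; exact: measurable_running_max.
have Woo k : (\int[P]_w `|W k w|%:E < +oo)%E.
  pose c : R := n%:R * L; have c0 : 0 <= c by rewrite mulr_ge0.
  have m20 w : 0 <= 2 * running_max n k w ^+ 2 :> R.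
    exact: (mulr_ge0 (ler0n R 2) (sqr_ge0 _)).
  have mm2' : measurable_fun setT (fun w => 2 * running_max n k w ^+ 2).
    exact: measurable_funM.
  have m120 w : 0 <= 1 + 2 * running_max n k w ^+ 2 := addr_ge0 ler01 (m20 w).
  apply: (@le_lt_trans _ _ (\int[P]_w (c * (1 + 2 * running_max n k w ^+ 2))%:E)%E).
    apply: ge0_le_integral_real => //.
    - exact: measurableT_comp.
    - by apply: measurable_funM => //; exact: measurable_funD.
    - move=> w; rewrite /W !normrM (ger0_norm (m0 k w)) normr_nat normrX.
      have h1 := exprn_le1D_even (S k w) n n.-1 (leq_pred n) en.
      have h2 := running_max_ge n k k w (leqnn k).
      have h3 : running_max n k w * `|S k w| ^+ n.-1 <= 1 + 2 * running_max n k w ^+ 2.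
        apply: (@le_trans _ _ (running_max n k w * (1 + running_max n k w))).
          by rewrite ler_wpM2l ?m0//; lra.
        by have := m0 k w; nra.
      have -> : running_max n k w * (n%:R * `|S k w| ^+ n.-1 * `|a k w|) =
         n%:R * `|a k w| * (running_max n k w * `|S k w| ^+ n.-1) by ring.
      apply: ler_pM => //; first by rewrite mulr_ge0.
      by rewrite ler_wpM2l.
  rewrite ge0_integralZl_real//; last exact: measurable_funD.
  rewrite ge0_integralD_real// integral_cst//= probability_setT mule1.
  rewrite ge0_integralZl_real//; last by move=> w; exact: sqr_ge0.
  apply: lte_mul_pinfty; rewrite ?lee_fin ?mulr_ge0//.
  rewrite lte_add_pinfty ?ltry//; apply: lte_mul_pinfty => //.
  exact: running_max_sqr_lty.
have cent k := past_centered k (W k) (pW k) (Woo k).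
have mp k : measurable_fun setT (fun w => Num.max (W k w * D k w) 0).
  by apply: measurable_maxr => //; exact: measurable_funM.
have mm k : measurable_fun setT (fun w => Num.max (- (W k w * D k w)) 0).
  by apply: measurable_maxr => //; apply: measurableT_comp => //; exact: measurable_funM.
have ge0m (x : R) : 0 <= Num.max x 0 by rewrite le_max lexx orbT.
pose Ip := (\sum_(k < N) \int[P]_w (Num.max (W k w * D k w) 0)%:E)%E.
have Ip0 : (0 <= 4%:E * Ip)%E.
  by rewrite mule_ge0// sume_ge0// => k _; apply: integral_ge0 => w _; rewrite lee_fin.
have Ioo : (4%:E * Ip < +oo)%E.
  apply: lte_mul_pinfty => //; apply: lte_sum_pinfty => k _.
  by case: (cent k).
(* [Ip] comes from the positive parts on the left and from the negative parts on the right; it is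
   finite and cancels. *)
have key : (\int[P]_w (running_max n N w ^+ 2)%:E + 4%:E * Ip <=
   4%:E * \int[P]_w (S N w ^+ (2 * n))%:E + 4%:E * Ip)%E.
  rewrite {2}/Ip (eq_bigr (fun k : 'I_N => \int[P]_w (Num.max (- (W k w * D k w)) 0)%:E)%E); last first.
    by move=> k _; case: (cent k).
  have mSn : measurable_fun setT (fun w => S N w ^+ (2 * n)).
    by apply: measurable_funX; exact: measurable_transform.
  have sp0 w : 0 <= \sum_(k < N) Num.max (W k w * D k w) 0 by exact: sumr_ge0.
  have sm0 w : 0 <= \sum_(k < N) Num.max (- (W k w * D k w)) 0 by exact: sumr_ge0.
  have msp : measurable_fun setT (fun w => \sum_(k < N) Num.max (W k w * D k w) 0).
    by apply: measurable_sum => k; exact: mp.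
  have msm : measurable_fun setT (fun w => \sum_(k < N) Num.max (- (W k w * D k w)) 0).
    by apply: measurable_sum => k; exact: mm.
  rewrite /Ip -(ge0_integral_sum_real P (fun k w => Num.max (W k w * D k w) 0))//.
  rewrite -(ge0_integral_sum_real P (fun k w => Num.max (- (W k w * D k w)) 0))//.
  rewrite -!ge0_integralZl_real// -!ge0_integralD_real//; first last.
  - exact: measurable_funM.
  - by move=> w; rewrite mulr_ge0.
  - by move=> w; exact: sqr_ge0.
  - exact: measurable_funM.
  - exact: measurable_funM.
  - by move=> w; rewrite mulr_ge0.
  - by move=> w; rewrite mulr_ge0.
  apply: ge0_le_integral_real => //.
  - by move=> w; rewrite addr_ge0 ?mulr_ge0// sqr_ge0.
  - by apply: measurable_funD => //; exact: measurable_funM.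
  - by apply: measurable_funD => //; exact: measurable_funM.
  move=> w.
  have x0 k : 0 <= S k w ^+ n by rewrite exprn_even_ge0.
  have := @doob_trajectorial R (fun k => S k w ^+ n) (fun k => running_max n k w) N x0
    erefl (fun k => erefl).
  rewrite -exprM mulnC => doob.
  have lin : \sum_(k < N) W k w * D k w <=
      \sum_(k < N) running_max n k w * (S k.+1 w ^+ n - S k w ^+ n).
    apply: ler_sum => k _; rewrite /W -[X in X <= _]mulrA ler_wpM2l ?m0//.
    rewrite lerBrDl transformS -mulrA.
    exact: exprn_even_ge_tangent.
  have spm : \sum_(k < N) Num.max (W k w * D k w) 0 -
     \sum_(k < N) Num.max (- (W k w * D k w)) 0 = \sum_(k < N) W k w * D k w.
    by rewrite -sumrB; apply: eq_bigr => k _; exact: maxr0B.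
  lra.
rewrite leeD2rE in key; last by rewrite ge0_fin_numE.
apply: le_trans key _; rewrite EFinM lee_wpmul2l ?lee_fin//.
exact: transform_moment.
Qed.

End martingale_transform.

(** * Differentiability and boundedness on an interval *)

Section interval_functions.
Context {R : realType}.
Implicit Types (l r x : R) (u v : R -> R).

(** Near an interior point the restriction to [[l, r]] excludes nothing, so the limits in [Ck_on]
    are ordinary derivatives there. *)
Lemma within_quotient_is_derive l r u x (c : R) : l < x < r ->
  (fun y => (u y - u x) / (y - x))
    @ within [set y | y \in `[l, r] /\ y != x] (nbhs x) --> c ->
  is_derive x (1 : R) u c.
Proof.
move=> /andP[lx xr] hc; apply/is_derive1_caratheodory.
exists (fun z => if z == x then c else (u z - u x) / (z - x)); split.
- move=> z; case: eqP => [->|/eqP]; first by rewrite !subrr mulr0.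
  by rewrite -subr_eq0 => /divfK->.
- apply/cvgrPdist_lt => e e0; move/cvgrPdist_lt : hc => /(_ e e0) hc.
  have xlr : \forall z \near x, z \in `]l, r[.
    by apply: near_in_itvoo; rewrite in_itv/= lx xr.
  move: hc; rewrite near_withinE => hc; rewrite eqxx.
  near=> z.
  case: (eqVneq z x) => [_|zx]; first by rewrite subrr normr0.
  have zlr : z \in `]l, r[ by near: z.
  have : [set y | y \in `[l, r] /\ y != x] z.
    by split => //; exact: subset_itv_oo_cc zlr.
  by near: z.
- by rewrite eqxx.
Unshelve. all: by end_near. Qed.

Lemma within_continuous_bounded l r u : l <= r -> {within `[l, r], continuous u} ->
  exists M, forall x, x \in `[l, r] -> `|u x| <= M.
Proof.
move=> lr cu; have [c _ cM] := EVT_max lr cu; have [e _ em] := EVT_min lr cu.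
exists (`|u c| + `|u e|) => x xlr.
have := cM x xlr; have := em x xlr.
have := ler_norm (u c); have := ler_norm (- u e); rewrite normrN.
have := normr_ge0 (u c); have := normr_ge0 (u e).
by rewrite ler_norml; lra.
Qed.

(** Meant for [f / g], which is controlled near the ends through its limits only; compactness
    handles the segment in between. *)
Lemma continuous_limits_bounded l r u (a b : R) : l < r ->
  {in `]l, r[, continuous u} -> u @ l^'+ --> a -> u @ r^'- --> b ->
  exists M, forall x, l < x < r -> `|u x| <= M.
Proof.
move=> lr cu ua ub.
have nl : \forall x \near l^'+, `|u x| <= `|a| + 1.
  move/cvgrPdist_lt : ua => /(_ 1 ltr01) ua; near=> x.
  have : `|a - u x| < 1 by near: x.
  by have := lerB_dist (u x) a; rewrite distrC; lra.
have nr : \forall x \near r^'-, `|u x| <= `|b| + 1.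
  move/cvgrPdist_lt : ub => /(_ 1 ltr01) ub; near=> x.
  have : `|b - u x| < 1 by near: x.
  by have := lerB_dist (u x) b; rewrite distrC; lra.
move: nl nr; rewrite !near_withinE => -[/= e1 e10 B1] [/= e2 e20 B2].
pose e := Num.min (Num.min e1 e2) (r - l) / 4.
have me : 0 < Num.min (Num.min e1 e2) (r - l) by rewrite !lt_min e10 e20 subr_gt0.
have ee1 : e < e1.
  have : Num.min (Num.min e1 e2) (r - l) <= e1 by rewrite !ge_min lexx.
  by rewrite /e; lra.
have ee2 : e < e2.
  have : Num.min (Num.min e1 e2) (r - l) <= e2 by rewrite !ge_min lexx orbT.
  by rewrite /e; lra.
have erl : e <= (r - l) / 4.
  have : Num.min (Num.min e1 e2) (r - l) <= r - l by rewrite ge_min lexx orbT.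
  by rewrite /e; lra.
have e0 : 0 < e by rewrite /e divr_gt0.
have cu' : {within `[l + e, r - e], continuous u}.
  apply: continuous_in_subspaceT => x; rewrite inE/= in_itv/= => /andP[x1 x2].
  by apply: cu; rewrite in_itv/=; lra.
have [|M HM] := within_continuous_bounded _ _ u _ cu'; first by lra.
exists (Num.max M (Num.max (`|a| + 1) (`|b| + 1))) => x /andP[lx xr].
rewrite !le_max; have [xl|xl] := ltrP x (l + e).
  by rewrite [X in _ || (X || _)]B1 ?orbT//= ltr_norml; lra.
have [rx|rx] := ltrP (r - e) x.
  by rewrite [X in _ || (_ || X)]B2 ?orbT//= ltr_norml; lra.
by rewrite HM// in_itv/= xl rx.
Unshelve. all: by end_near. Qed.

End interval_functions.

(** * Derivatives of the Lamperti transform and of its inverse *)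

Section lamperti.
Context {R : realType}.
Variables (l r w0 : R) (g Phiinv : R -> R) (LPhi : R).
Hypothesis gc : {in `]l, r[, continuous g}.
Hypothesis g0 : forall x, l < x < r -> 0 < g x.
Hypothesis lw0r : l < w0 < r.
Hypothesis PhiK : forall y, l < Phiinv y < r /\ Phi g w0 (Phiinv y) = y.
Hypothesis Phiinv_lip : forall x y, `|Phiinv x - Phiinv y| <= LPhi * `|x - y|.
Local Notation mu := (@lebesgue_measure R).

Lemma Phi_is_derive x : l < x < r -> is_derive x (1 : R) (Phi g w0) (g x)^-1.
Proof.
move=> lxr; have /andP[lx xr] := lxr; have /andP[lw wr] := lw0r.
(* On [a, b], which contains w0 and x in its interior, both branches of [Phi] become F z - F w0 for
   the one primitive F based at a. *)
pose a := (l + Num.min w0 x) / 2; pose b := (r + Num.max w0 x) / 2.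
have mw : Num.min w0 x <= w0 by rewrite ge_min lexx.
have mx : Num.min w0 x <= x by rewrite ge_min lexx orbT.
have Mw : w0 <= Num.max w0 x by rewrite le_max lexx.
have Mx : x <= Num.max w0 x by rewrite le_max lexx orbT.
have lm : l < Num.min w0 x by rewrite lt_min lw lx.
have Mr : Num.max w0 x < r by rewrite gt_max wr xr.
have la : l < a by rewrite /a; lra.
have aw : a < w0 by rewrite /a; lra.
have ax : a < x by rewrite /a; lra.
have br : b < r by rewrite /b; lra.
have wb : w0 < b by rewrite /b; lra.
have xb : x < b by rewrite /b; lra.
pose k z := (g z)^-1.
have kc z : l < z < r -> {for z, continuous k}.
  move=> lzr; apply: continuousV; first by rewrite gt_eqF// g0.
  by apply: gc; rewrite in_itv.
have kint : mu.-integrable `[a, b] (EFin \o k).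
  apply: continuous_compact_integrable; first exact: segment_compact.
  apply: continuous_in_subspaceT => z; rewrite inE/= in_itv/= => /andP[z1 z2].
  by apply: kc; apply/andP; split; lra.
pose F z := Rintegral mu `[a, z] k.
have FB y z : a <= y -> y <= z -> z <= b -> F z - F y = Rintegral mu `[y, z] k.
  move=> ay yz zb; rewrite /F Rintegral_itvB ?bnd_simp//.
    rewrite Rintegral_itv_obnd_cbnd//.
    apply: integrableS kint => //; apply: subset_itv; rewrite bnd_simp//.
    by apply: integrableS kint => //; apply: subset_itvl; rewrite bnd_simp.
have PhiE z : a < z < b -> F z - F w0 = Phi g w0 z.
  move=> /andP[az zb]; rewrite /Phi; case: leP => wz.
    by rewrite FB// ltW.
  by rewrite -FB// ?ltW// opprB.
apply: (@near_eq_is_derive _ _ _ (fun z => F z - F w0)).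
  near=> z; apply: PhiE; near: z.
  have : \forall z \near x, z \in `]a, b[ by apply: near_in_itvoo; rewrite in_itv/= ax xb.
  by apply: filterS => z; rewrite in_itv.
have [dF F'] := @continuous_FTC1_closed R k a x b xb kint ax (kc x lxr).
have DF : is_derive x (1 : R) F (g x)^-1.
  by have := derivableP dF; rewrite -derive1E F'.
by apply: is_derive_eq; rewrite subr0.
Unshelve. all: by end_near. Qed.

(** The slope function of [Phiinv] at y is the inverse of that of [Phi], composed with [Phiinv]. It
    is continuous at y by the Lipschitz hypothesis, and the slope never vanishes: a zero at z would
    force z = y, where its value is 1 / g. *)
Lemma Phiinv_is_derive y : is_derive y (1 : R) Phiinv (g (Phiinv y)).
Proof.
have [lxr PhiE] := PhiK y; set x := Phiinv y in lxr PhiE *.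
have gx : g x != 0 by rewrite gt_eqF// g0.
have /is_derive1_caratheodory[c [cE cc cx]] := Phi_is_derive x lxr.
have LPhi0 : 0 <= LPhi.
  have := Phiinv_lip 1 0; rewrite subr0 normr1 mulr1; exact: le_trans (normr_ge0 _).
have Pc : {for y, continuous Phiinv}.
  apply/cvgrPdist_lt => e e0; exists (e / (LPhi + 1)).
    by rewrite /= divr_gt0// ltr_wpDl.
  move=> z /=; rewrite ltr_pdivlMr ?ltr_wpDl// => h.
  apply: le_lt_trans (Phiinv_lip y z) _; apply: le_lt_trans h.
  by rewrite mulrDr mulr1 [LPhi * _]mulrC lerDl.
pose q z := c (Phiinv z).
have qc : {for y, continuous q} by apply: continuous_comp.
have qy : q y = (g x)^-1 by rewrite /q -/x.
apply/is_derive1_caratheodory.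
exists (fun z => (q z)^-1); split; last by rewrite qy invrK.
- move=> z; have := cE (Phiinv z); have [_ ->] := PhiK z; rewrite PhiE => e.
  have [q0|q0] := eqVneq (q z) 0.
    have /eqP := e; rewrite -/(q z) q0 mul0r subr_eq0 => /eqP zy.
    by move: q0; rewrite zy qy => /eqP; rewrite invr_eq0 (negbTE gx).
  by rewrite e -/(q z) mulrA mulVf// mul1r.
- by apply: continuousV => //; rewrite qy invr_neq0.
Qed.

End lamperti.

(** * Boundedness of the transformed drift and its derivatives *)

Section drift.
Context {R : realType}.
Variables (l r w0 : R) (f g Phiinv : R -> R) (LPhi : R).
Hypothesis lr : l < r.
Hypothesis Cf : Ck_on l r 2 f.
Hypothesis Cg : Ck_on l r 3 g.
Hypothesis g0 : forall x, l < x < r -> 0 < g x.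
Hypothesis lw0r : l < w0 < r.
Hypothesis fgl : exists a : R, (fun x => f x / g x) @ l^'+ --> a.
Hypothesis fgr : exists b : R, (fun x => f x / g x) @ r^'- --> b.
Hypothesis PhiK : forall y, l < Phiinv y < r /\ Phi g w0 (Phiinv y) = y.
Hypothesis Phiinv_lip : forall x y, `|Phiinv x - Phiinv y| <= LPhi * `|x - y|.

Lemma Htilde_C2_bounded : exists H1 H2 : R -> R,
  [/\ forall x, is_derive x (1 : R) (Htilde f g Phiinv) (H1 x),
      forall x, is_derive x (1 : R) H1 (H2 x) &
      exists M, forall x, [/\ `|Htilde f g Phiinv x| <= M, `|H1 x| <= M & `|H2 x| <= M]].
Proof.
have [F [F0 [Fc Fd]]] := Cf; have [G [G0 [Gc Gd]]] := Cg.
have itvW x : l < x < r -> x \in `[l, r].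
  by move=> /andP[lx xr]; rewrite in_itv/= !ltW.
have FD i x : (i < 2)%N -> l < x < r -> is_derive x (1 : R) (F i) (F i.+1 x).
  by move=> i2 lxr; apply: (within_quotient_is_derive l r) => //; apply: Fd => //; exact: itvW.
have GD i x : (i < 3)%N -> l < x < r -> is_derive x (1 : R) (G i) (G i.+1 x).
  by move=> i2 lxr; apply: (within_quotient_is_derive l r) => //; apply: Gd => //; exact: itvW.
have cont (u : R -> R) c x : is_derive x (1 : R) u c -> {for x, continuous u}.
  by move=> du; apply/differentiable_continuous/derivable1_diffP.
have gN0 x : l < x < r -> g x != 0 by move=> /g0 gx; rewrite gt_eqF.
have gc : {in `]l, r[, continuous g}.
  move=> x; rewrite in_itv/= => lxr; rewrite -G0.
  exact: cont (GD 0%N x isT lxr).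
have fD x : l < x < r -> is_derive x (1 : R) f (F 1%N x) by move=> lxr; rewrite -F0; exact: FD.
have gD x : l < x < r -> is_derive x (1 : R) g (G 1%N x) by move=> lxr; rewrite -G0; exact: GD.
pose rho x := f x / g x.
have rhoD x : l < x < r -> is_derive x (1 : R) rho ((F 1%N x - rho x * G 1%N x) / g x).
  move=> lxr; have ? := fD x lxr; have ? := is_deriveV (gN0 x lxr) (gD x lxr).
  apply: is_derive_eq; rewrite /rho /= /GRing.scale /=.
  by have := gN0 x lxr; move: (f x) (g x) => fx gx gx0; field.
have dg x : l < x < r -> derive1 g x = G 1%N x.
  by move=> lxr; have ? := gD x lxr; rewrite derive1E derive_val.
have PD y := @Phiinv_is_derive R l r w0 g Phiinv LPhi gc g0 lw0r PhiK Phiinv_lip y.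
have lP y : l < Phiinv y < r by case: (PhiK y).
(* Differentiating u o [Phiinv] amounts to replacing u by g u', and g rho' = f' - rho g' contains no
   new quotient. So [h1] and [h2] are polynomials in rho, f', f'', g and the derivatives of g up to
   order 3, all bounded on (l, r). *)
pose h0 x := rho x - 2^-1 * G 1%N x.
pose h1 x := F 1%N x - rho x * G 1%N x - 2^-1 * (G 2%N x * g x).
pose h2 x := F 2%N x * g x - (F 1%N x - rho x * G 1%N x) * G 1%N x
   - rho x * G 2%N x * g x - 2^-1 * (G 3%N x * g x + G 2%N x * G 1%N x) * g x.
have h0D x : l < x < r -> is_derive x (1 : R) h0 (h1 x / g x).
  move=> lxr; have ? := rhoD x lxr; have ? := GD 1%N x isT lxr.
  apply: is_derive_eq; rewrite /h1 /GRing.scale /=.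
  by have := gN0 x lxr; move: (rho x) (g x) => fx gx gx0; field.
have h1D x : l < x < r -> is_derive x (1 : R) h1 (h2 x / g x).
  move=> lxr; have ? := rhoD x lxr; have ? := GD 1%N x isT lxr.
  have ? := GD 2%N x isT lxr; have ? := FD 1%N x isT lxr; have ? := gD x lxr.
  apply: is_derive_eq; rewrite /h2 /GRing.scale /=.
  by have := gN0 x lxr; move: (rho x) (g x) => fx gx gx0; field.
have HtE : Htilde f g Phiinv = h0 \o Phiinv.
  by apply/funext => y; rewrite /Htilde /= /h0 dg.
exists (h1 \o Phiinv), (h2 \o Phiinv); split.
- move=> y; rewrite HtE; apply: (is_derive_eq (is_derive1_comp (h0D _ (lP y)) (PD y))).
  by rewrite /= divfK// gN0.
- move=> y; apply: (is_derive_eq (is_derive1_comp (h1D _ (lP y)) (PD y))).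
  by rewrite /= divfK// gN0.
have [[a fa] [b fb]] := (fgl, fgr).
have rhoc : {in `]l, r[, continuous rho}.
  by move=> x; rewrite in_itv/= => lxr; exact: cont (rhoD x lxr).
have [Mr Hr] := @continuous_limits_bounded R l r rho a b lr rhoc fa fb.
have [F1b HF1] := within_continuous_bounded l r _ (ltW lr) (Fc 1%N isT).
have [F2b HF2] := within_continuous_bounded l r _ (ltW lr) (Fc 2%N isT).
have [G0b HG0] := within_continuous_bounded l r _ (ltW lr) (Gc 0%N isT).
have [G1b HG1] := within_continuous_bounded l r _ (ltW lr) (Gc 1%N isT).
have [G2b HG2] := within_continuous_bounded l r _ (ltW lr) (Gc 2%N isT).
have [G3b HG3] := within_continuous_bounded l r _ (ltW lr) (Gc 3%N isT).
rewrite G0 in HG0.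
have bM (x y A B : R) : `|x| <= A -> `|y| <= B -> `|x * y| <= A * B.
  by move=> xA yB; rewrite normrM; apply: ler_pM.
have bB (x y A B : R) : `|x| <= A -> `|y| <= B -> `|x - y| <= A + B.
  by move=> xA yB; rewrite (le_trans (ler_normB _ _))// lerD.
have bD (x y A B : R) : `|x| <= A -> `|y| <= B -> `|x + y| <= A + B.
  by move=> xA yB; rewrite (le_trans (ler_normD _ _))// lerD.
have b2 : `|2^-1 : R| <= 2^-1 by rewrite ger0_norm.
have B0 x : l < x < r -> `|h0 x| <= Mr + 2^-1 * G1b.
  move=> lxr; have lxr' := itvW x lxr.
  by apply: (bB); [exact: Hr|apply: (bM) => //; exact: HG1].
have B1 x : l < x < r -> `|h1 x| <= F1b + Mr * G1b + 2^-1 * (G2b * G0b).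
  move=> lxr; have lxr' := itvW x lxr; have hr := Hr x lxr.
  apply: (bB); last by apply: (bM) => //; apply: (bM); [exact: HG2|exact: HG0].
  by apply: (bB); [exact: HF1|apply: (bM) => //; exact: HG1].
have B2 x : l < x < r -> `|h2 x| <= F2b * G0b + (F1b + Mr * G1b) * G1b +
    Mr * G2b * G0b + 2^-1 * (G3b * G0b + G2b * G1b) * G0b.
  move=> lxr; have lxr' := itvW x lxr; have hr := Hr x lxr.
  have := HF1 x lxr'; have := HF2 x lxr'; have := HG0 x lxr'; have := HG1 x lxr'.
  have := HG2 x lxr'; have := HG3 x lxr' => ? ? ? ? ? ?.
  apply: (bB); first (apply: (bB); first (apply: (bB))).
  - exact: bM.
  - by apply: (bM) => //; apply: (bB) => //; exact: bM.
  - by apply: (bM) => //; exact: bM.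
  - by apply: (bM) => //; apply: (bM) => //; apply: (bD); exact: bM.
eexists (Num.max _ (Num.max _ _)) => y; have ly := lP y; split.
- by rewrite HtE le_max; apply/orP; left; exact: B0.
- by rewrite !le_max; apply/orP; right; apply/orP; left; exact: B1.
- by rewrite !le_max; apply/orP; right; apply/orP; right; exact: B2.
Qed.

End drift.

(** * Mean value inequalities *)

Section mean_value.
Context {R : realType}.
Implicit Types (u du : R -> R) (a b C : R).

Lemma is_derive_within_continuous u du a b :
  (forall x, is_derive x (1 : R) u (du x)) -> {within `[a, b], continuous u}.
Proof.
move=> Du; apply: continuous_subspaceT => x.
by apply/differentiable_continuous/derivable1_diffP; case: (Du x).
Qed.

Lemma mean_value_le u du a b C : a <= b -> {within `[a, b], continuous u} ->
  (forall x, x \in `]a, b[ -> is_derive x (1 : R) u (du x)) ->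
  (forall x, x \in `[a, b] -> `|du x| <= C) -> `|u b - u a| <= C * (b - a).
Proof.
move=> ab cu Du duC; have [c cab ->] := MVT_segment ab Du cu.
by rewrite normrM (ger0_norm (x := b - a)) ?subr_ge0// ler_wpM2r ?subr_ge0// duC.
Qed.

Lemma derive_bounded_lipschitz u du C :
  (forall x, is_derive x (1 : R) u (du x)) -> (forall x, `|du x| <= C) ->
  forall x y, `|u x - u y| <= C * `|x - y|.
Proof.
move=> Du duC x y; wlog xy : x y / y <= x.
  by move=> W; case/orP: (le_total y x) => h; [exact: W|rewrite distrC [`|x - y|]distrC; exact: W].
rewrite (ger0_norm (x := x - y)) ?subr_ge0//.
by apply: (mean_value_le _ du) => //; exact: is_derive_within_continuous Du.
Qed.

(** The intermediate point lies within |x| of a, so one use of the mean value theorem suffices; the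
    factor 1/2 of Taylor's formula is given up. *)
Lemma derive_lipschitz_taylor u du C :
  (forall x, is_derive x (1 : R) u (du x)) ->
  (forall x y, `|du x - du y| <= C * `|x - y|) ->
  forall a x, `|u (a + x) - u a - du a * x| <= C * x ^+ 2.
Proof.
move=> Du duC a x.
have C0 : 0 <= C.
  by have := duC 1 0; rewrite subr0 normr1 mulr1; exact: le_trans (normr_ge0 _).
suff [c cx ->] : exists2 c, `|c - a| <= `|x| & u (a + x) - u a = du c * x.
  rewrite -mulrBl normrM -[x ^+ 2]real_normK ?num_real// expr2 mulrA ler_wpM2r//.
  by rewrite (le_trans (duC _ _))// ler_wpM2l.
case/orP: (le_total 0 x) => x0.
  have ax : a <= a + x by rewrite lerDl.
  have [c] := MVT_segment ax (fun z _ => Du z) (is_derive_within_continuous _ _ _ _ Du).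
  rewrite in_itv/= => /andP[ac cx] e; exists c; last by rewrite e addrC addKr.
  by rewrite (ger0_norm x0) ger0_norm ?subr_ge0//; lra.
have ax : a + x <= a by rewrite gerDl.
have [c] := MVT_segment ax (fun z _ => Du z) (is_derive_within_continuous _ _ _ _ Du).
rewrite in_itv/= => /andP[ac cx] e; exists c; last by rewrite -opprB e; ring.
by rewrite (ler0_norm x0) ler0_norm ?subr_le0//; lra.
Qed.

End mean_value.

(** * Error of one step and its accumulation *)

Section splitting_step.
Context {R : realType}.
Variables (H H1 : R -> R) (L mu : R).
Hypothesis L0 : 0 <= L.
Hypothesis Hmu : forall x, `|H x + mu| <= L.
Hypothesis Hlip : forall x y, `|H x - H y| <= L * `|x - y|.
Hypothesis Htaylor : forall a x, `|H (a + x) - H a - H1 a * x| <= L * x ^+ 2.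

(* Gronwall: (y - z)^2 e^(-2Lt) is nonincreasing. *)
Lemma flow_lipschitz (y z : R -> R) s t : s <= t ->
  (forall t, is_derive t (1 : R) y (H (y t))) ->
  (forall t, is_derive t (1 : R) z (H (z t))) ->
  `|y t - z t| <= expR (L * (t - s)) * `|y s - z s|.
Proof.
move=> st Dy Dz.
pose v x := (y x - z x) ^+ 2 * expR (- (2 * L) * x).
pose dv x := (2 * (y x - z x) * (H (y x) - H (z x)) - 2 * L * (y x - z x) ^+ 2)
  * expR (- (2 * L) * x).
have Dv x : is_derive x (1 : R) v (dv x).
  have ? := Dy x; have ? := Dz x.
  have De : is_derive x (1 : R) (fun x => expR (- (2 * L) * x)) (expR (- (2 * L) * x) * - (2 * L)).
    have ? : is_derive x (1 : R) (fun x => - (2 * L) * x) (- (2 * L)).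
      by apply: is_derive_eq; rewrite /GRing.scale /= mulr1.
    exact: (is_derive1_comp (f := expR)).
  apply: is_derive_eq; rewrite /dv /GRing.scale /=; ring.
have dv0 x : dv x <= 0.
  rewrite /dv mulr_le0_ge0 ?expR_ge0// subr_le0.
  have : (y x - z x) * (H (y x) - H (z x)) <= L * (y x - z x) ^+ 2.
    apply: le_trans (ler_norm _) _; rewrite normrM -[(y x - z x) ^+ 2]real_normK ?num_real//.
    by rewrite expr2 mulrCA ler_wpM2l// Hlip.
  by rewrite -!mulrA; lra.
have vst : v t <= v s.
  have [c _] := MVT_segment st (fun z _ => Dv z) (is_derive_within_continuous _ _ _ _ Dv).
  move=> e; rewrite -subr_le0 e mulr_le0_ge0 ?subr_ge0//.
have e0 : 0 <= expR (L * (t - s)) by exact: expR_ge0.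
rewrite -ler_sqr ?nnegrE ?mulr_ge0// exprMn !real_normK ?num_real//.
have -> : expR (L * (t - s)) ^+ 2 = expR (2 * L * t) * expR (- (2 * L) * s).
  by rewrite -expRM_natl -expRD; congr expR; ring.
have : v t * expR (2 * L * t) <= v s * expR (2 * L * t) by rewrite ler_wpM2r// expR_ge0.
rewrite {1}/v -mulrA -expRD mulNr addNr expR0 mulr1 => /le_trans; apply.
by rewrite /v le_eqVlt; apply/orP; left; apply/eqP; ring.
Qed.

(** L times three displacements per unit of dt: that of the flow, as |H| <= L + |mu|; that of Y - b,
    whose derivative is at most L; and that of b inside a cell of the fine grid. *)
Definition local_error_cst := L * (L + `|mu|) + L * L + L.

Lemma local_error_cst_ge0 : 0 <= local_error_cst.
Proof. by rewrite !addr_ge0 ?mulr_ge0 ?addr_ge0. Qed.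

Variables (t0 dt : R) (K : nat) (b Y y : R -> R).
Hypothesis dt0 : 0 < dt.
Hypothesis K0 : (0 < K)%N.
Let h := dt / K%:R.
Let V t := Y t - b t.
Hypothesis Vc : {within `[t0, t0 + dt], continuous V}.
Hypothesis VD : forall t, t \in `]t0, t0 + dt[ -> is_derive t (1 : R) V (H (Y t) + mu).
Hypothesis yD : forall t, is_derive t (1 : R) y (H (y t)).
Hypothesis b_modulus : forall s t, s \in `[t0, t0 + dt] -> t \in `[t0, t0 + dt] ->
  `|s - t| <= h -> `|b s - b t| <= dt.
Let beta (i : nat) := b (t0 + i%:R * h) - b t0.

Let h0 : 0 < h. Proof. by rewrite divr_gt0// ltr0n. Qed.
Let hK : K%:R * h = dt. Proof. by rewrite /h mulrC divfK// pnatr_eq0 -lt0n. Qed.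

(* The nonlinearity is expanded around the numerical value y t0, which only
   depends on the past increments, rather than around Y t0. *)
Lemma cell_error i : (i < K)%N ->
  `|(y (t0 + i.+1%:R * h) + mu * (i.+1%:R * h) - V (t0 + i.+1%:R * h))
    - (y (t0 + i%:R * h) + mu * (i%:R * h) - V (t0 + i%:R * h))
    + h * (H1 (y t0) * beta i)|
  <= h * (L * `|y t0 - Y t0| + local_error_cst * dt + L * beta i ^+ 2).
Proof.
move=> iK; pose E t := y t + mu * (t - t0) - V t.
pose p := t0 + i%:R * h; pose q := t0 + i.+1%:R * h.
have ih0 : 0 <= i%:R * h by rewrite mulr_ge0// ltW.
have iSK : i.+1%:R * h <= dt by rewrite -hK ler_wpM2r ?ler_nat// ltW.
have pq : q = p + h by rewrite /q /p -natr1; ring.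
have pq_lt : p < q by rewrite pq ltrDl.
have t0p : t0 <= p by rewrite /p lerDl.
have qt : q <= t0 + dt by rewrite /q lerD2l.
have sub : `[p, q] `<=` `[t0, t0 + dt] by apply: subset_itv; rewrite bnd_simp.
have Ec : {within `[p, q], continuous E}.
  have Vc' := continuous_subspaceW sub Vc.
  pose u t := y t + mu * (t - t0).
  have -> : E = u - V by apply/funext => z.
  have uD z : is_derive z (1 : R) u (H (y z) + mu).
    by have ? := yD z; apply: is_derive_eq; rewrite /GRing.scale /=; ring.
  move=> x; apply: continuousB; last exact: Vc'.
  exact: (is_derive_within_continuous u _ p q uD).
have ED x : x \in `]p, q[ -> is_derive x (1 : R) E (H (y x) - H (Y x)).
  rewrite in_itv/= => /andP[px xq].
  have ? := yD x.
  have ? : is_derive x (1 : R) V (H (Y x) + mu).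
    by apply: VD; rewrite in_itv/= (le_lt_trans t0p px) (lt_le_trans xq qt).
  by apply: is_derive_eq; rewrite /GRing.scale /=; ring.
(* The path b has dropped out of the derivative of E, so over the cell the error changes by exactly
   h (H (y c) - H (Y c)). *)
have [c] := MVT pq_lt ED Ec.
rewrite in_itv/= => /andP[pc cq] EE.
have t0c : t0 <= c by lra.
have cdt : c <= t0 + dt by lra.
have Habs x : `|H x| <= L + `|mu|.
  have -> : H x = (H x + mu) - mu by ring.
  by rewrite (le_trans (ler_normB _ _))// lerD.
have yct : `|y c - y t0| <= (L + `|mu|) * dt.
  apply: (@le_trans _ _ ((L + `|mu|) * (c - t0))).
    have yc := is_derive_within_continuous y _ t0 c yD.
    exact: (mean_value_le y (fun z => H (y z)) t0 c (L + `|mu|) t0c yc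
      (fun z _ => yD z) (fun z _ => Habs (y z))).
  by rewrite ler_wpM2l ?addr_ge0//; lra.
have Vct : `|V c - V t0| <= L * dt.
  apply: (@le_trans _ _ (L * (c - t0))).
    have Vtc : {within `[t0, c], continuous V}.
      by apply: continuous_subspaceW Vc; apply: subset_itvl; rewrite bnd_simp.
    have VtD x : x \in `]t0, c[ -> is_derive x (1 : R) V (H (Y x) + mu).
      rewrite in_itv/= => /andP[x1 x2]; apply: VD.
      by rewrite in_itv/= x1/=; lra.
    exact: (mean_value_le V (fun z => H (Y z) + mu) t0 c L t0c Vtc VtD
      (fun z _ => Hmu (Y z))).
  by rewrite ler_wpM2l//; lra.
have bcp : `|b c - b p| <= dt.
  apply: b_modulus.
  - by rewrite in_itv/= t0c cdt.
  - by rewrite in_itv/= t0p/=; lra.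
  - by rewrite ger0_norm ?subr_ge0; [lra|exact: ltW].
have A1 : `|H (y c) - H (y t0)| <= L * ((L + `|mu|) * dt).
  by rewrite (le_trans (Hlip _ _))// ler_wpM2l.
have A2 : `|H (Y c) - H (y t0 + beta i)| <= L * (`|y t0 - Y t0| + L * dt + dt).
  rewrite (le_trans (Hlip _ _))// ler_wpM2l//.
  (* The unknown point c is replaced by the left node p in the Brownian part; the modulus of
     continuity makes this cost at most dt. *)
  have -> : Y c - (y t0 + beta i) = - (y t0 - Y t0) + (V c - V t0) + (b c - b p).
    by rewrite /V /beta -/p; ring.
  by rewrite (le_trans (ler_normD _ _))// lerD// (le_trans (ler_normD _ _))// normrN lerD.
have A3 := Htaylor (y t0) (beta i).
have -> : (y q + mu * (i.+1%:R * h) - V q) - (y p + mu * (i%:R * h) - V p) = E q - E p.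
  by rewrite /E /q /p; ring.
rewrite EE pq addrAC subrr add0r [_ * h]mulrC -mulrDr normrM gtr0_norm// ler_wpM2l; [by []|exact: ltW|].
have -> : H (y c) - H (Y c) + H1 (y t0) * beta i = (H (y c) - H (y t0))
   - (H (Y c) - H (y t0 + beta i)) - (H (y t0 + beta i) - H (y t0) - H1 (y t0) * beta i) by ring.
rewrite (le_trans (ler_normB _ _))// (le_trans (lerD (ler_normB _ _) (lexx _)))//.
rewrite (le_trans (lerD (lerD A1 A2) A3))// /local_error_cst le_eqVlt.
by apply/orP; left; apply/eqP; ring.
Qed.

Lemma step_error :
  `|(y (t0 + dt) + mu * dt + b (t0 + dt) - b t0 - Y (t0 + dt)) - (y t0 - Y t0)
    + H1 (y t0) * (h * \sum_(i < K) beta i)|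
  <= dt * L * `|y t0 - Y t0| + local_error_cst * dt ^+ 2 + L * (h * \sum_(i < K) beta i ^+ 2).
Proof.
pose E i := y (t0 + i%:R * h) + mu * (i%:R * h) - V (t0 + i%:R * h).
pose A := L * `|y t0 - Y t0| + local_error_cst * dt.
have ind n : (n <= K)%N ->
    `|E n - E 0%N + H1 (y t0) * (h * \sum_(i < n) beta i)|
      <= n%:R * h * A + L * (h * \sum_(i < n) beta i ^+ 2).
  elim: n => [|n IH] nK.
    by rewrite !big_ord0 subrr !mul0r !mulr0 !addr0 normr0.
  have c := cell_error n nK; have {}IH := IH (ltnW nK).
  rewrite !big_ord_recr/=.
  have -> : E n.+1 - E 0%N + H1 (y t0) * (h * (\sum_(i < n) beta i + beta n)) =
    (E n.+1 - E n + h * (H1 (y t0) * beta n)) +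
    (E n - E 0%N + H1 (y t0) * (h * \sum_(i < n) beta i)) by ring.
  apply: le_trans (ler_normD _ _) _; apply: le_trans (lerD c IH) _.
  by rewrite -natr1 le_eqVlt /A; apply/orP; left; apply/eqP; ring.
have := ind K (leqnn K); rewrite /E hK mul0r mulr0 addr0 addr0 /V /A.
set s1 := \sum_(i < K) beta i; set s2 := \sum_(i < K) beta i ^+ 2.
have -> : y (t0 + dt) + mu * dt - (Y (t0 + dt) - b (t0 + dt)) - (y t0 - (Y t0 - b t0)) =
  (y (t0 + dt) + mu * dt + b (t0 + dt) - b t0 - Y (t0 + dt)) - (y t0 - Y t0) by ring.
move=> /le_trans; apply; rewrite le_eqVlt; apply/orP; left; apply/eqP; ring.
Qed.

End splitting_step.

(** The recursion is summed for e + Z before Z is bounded in absolute value; this preserves the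
    cancellation inside Z, and Gronwall is applied to |e| <= |e + Z| + Zs. *)
Lemma global_error {R : realType} (L c1 dt : R) (e Z q : nat -> R) (Zs : R) M :
  0 <= L -> 0 <= c1 -> 0 <= dt -> 0 <= Zs -> (forall m, 0 <= q m) -> e 0%N = 0 -> Z 0%N = 0 ->
  (forall m, (m < M)%N -> `|e m.+1 - e m + (Z m.+1 - Z m)|
     <= dt * L * `|e m| + c1 * dt ^+ 2 + L * q m) ->
  (forall m, (m <= M)%N -> `|Z m| <= Zs) ->
  forall m, (m <= M)%N ->
    `|e m| <= (Zs + c1 * (M%:R * dt) * dt + L * \sum_(k < M) q k) * expR (L * (M%:R * dt)).
Proof.
move=> L0 c0 dt0 Zs0 q0 e0 Z0 step ZZs.
have d20 : 0 <= dt ^+ 2 by exact: sqr_ge0.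
have part m : (m <= M)%N -> `|e m + Z m| <=
    dt * L * \sum_(k < m) `|e k| + c1 * dt ^+ 2 * m%:R + L * \sum_(k < m) q k.
  elim: m => [|m IH] mM; first by rewrite e0 Z0 !big_ord0 !mulr0 !addr0 normr0.
  rewrite !big_ord_recr/=.
  have -> : e m.+1 + Z m.+1 = (e m.+1 - e m + (Z m.+1 - Z m)) + (e m + Z m) by ring.
  apply: le_trans (ler_normD _ _) _; apply: le_trans (lerD (step m mM) (IH (ltnW mM))) _.
  by rewrite -natr1 le_eqVlt; apply/orP; left; apply/eqP; ring.
set A := _ + _ + _.
have sq m : (m <= M)%N -> \sum_(k < m) q k <= \sum_(k < M) q k.
  move=> mM; rewrite -!(big_mkord xpredT) (big_cat_nat (n := m) _ mM)//=.
  by rewrite lerDl sumr_ge0.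
have A0 : 0 <= A.
  by rewrite /A addr_ge0 ?addr_ge0 ?mulr_ge0 ?sumr_ge0.
have gron := @discrete_gronwall R (fun m => `|e m|) A (dt * L) M A0 (mulr_ge0 dt0 L0).
move=> m mM; apply: le_trans (gron _ m mM) _.
  move=> n nM; have := part n nM; have := ZZs n nM; have := sq n nM.
  have : `|e n| <= `|e n + Z n| + `|Z n|.
    by have := ler_normB (e n + Z n) (Z n); rewrite addrK.
  have cn : c1 * dt ^+ 2 * n%:R <= c1 * (M%:R * dt) * dt.
    have -> : c1 * (M%:R * dt) * dt = c1 * dt ^+ 2 * M%:R by ring.
    by rewrite ler_wpM2l ?ler_nat// mulr_ge0.
  move=> h1 h2 h3 h4; have : L * \sum_(k < n) q k <= L * \sum_(k < M) q k by rewrite ler_wpM2l.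
  by rewrite /A; lra.
rewrite ler_wpM2l// (le_trans (ler_weXn2l _ mM))//; first by rewrite lerDl mulr_ge0.
have -> : L * (M%:R * dt) = M%:R * (dt * L) by ring.
rewrite expRM_natl lerXn2r ?nnegrE ?expR_ge0 ?expR_ge1Dx//.
by rewrite addr_ge0 ?mulr_ge0.
Qed.

(** * Regularity of the paths *)

Section path_regularity.
Context {R : realType}.
Local Notation mu := (@lebesgue_measure R).

Lemma integral_equation_is_derive (Y b k : R -> R) (c T : R) :
  {within `[0, T], continuous k} ->
  (forall t : R, 0 <= t <= T -> Y t = c + Rintegral mu `[0, t] k + b t) ->
  forall t : R, 0 < t < T -> is_derive t (1 : R) (fun t => Y t - b t) (k t).
Proof.
move=> kc YE t /andP[t0 tT].
have kint : mu.-integrable `[0, T] (EFin \o k).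
  by apply: continuous_compact_integrable; [exact: segment_compact|].
have kt : {for t, continuous k}.
  have oT : 0 < T := lt_trans t0 tT.
  by have [+ _ _] := (continuous_within_itvP _ oT).1 kc; apply; rewrite in_itv/= t0.
have [dF F'] := @continuous_FTC1_closed R k 0 t T tT kint t0 kt.
have DF := derivableP dF; rewrite -derive1E F' in DF.
pose G (z : R) : R := Rintegral mu `[0, z] k + c.
apply: (@near_eq_is_derive _ _ _ G); last first.
  by apply: is_derive_eq; rewrite addr0.
have : \forall z \near t, z \in `]0, T[ by apply: near_in_itvoo; rewrite in_itv/= t0.
apply: filterS => z; rewrite in_itv/= => /andP[z0 zT].
by rewrite YE ?ltW// addrK addrC.
Qed.

(** Uniform continuity by compactness, stated for all large K because the threshold depends on the
    path and Fatou's lemma asks for no more. With e = dt the mesh is that of K + 1 cells per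
    step. *)
Lemma uniform_modulus (b : R -> R) (T e : R) : 0 < e -> continuous b ->
  \forall K \near \oo, forall s : R, s \in `[0, T] -> forall t : R,
    `|s - t| <= e / K.+1%:R -> `|b s - b t| <= e.
Proof.
move=> e0 bc.
have /compact_near_coveringP cov := @segment_compact R 0 T.
have := cov nat \oo (fun K s => forall t, `|s - t| <= e / K.+1%:R -> `|b s - b t| <= e) _.
have loc (s : R) : `[0, T]%classic s -> \forall x \near s & K \near \oo,
    forall t, `|x - t| <= e / K.+1%:R -> `|b x - b t| <= e.
  move=> _; have := bc s => /cvgrPdist_lt /(_ (e / 2)).
  rewrite divr_gt0// => /(_ isT) [/= dl dl0 near_b].
  exists (ball s (dl / 2), [set K | K.+1%:R^-1 < dl / 2 / e]) => /=.
    split; first by apply: nbhsx_ballx; rewrite divr_gt0.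
    have p : 0 < dl / 2 / e by rewrite !divr_gt0.
    exact: (near_infty_natSinv_lt (PosNum p)).
  move=> [x K] [/= xs Ks] t xt.
  have Ke : e / K.+1%:R < dl / 2.
    by rewrite mulrC -ltr_pdivlMr.
  have bx : `|b s - b x| < e / 2.
    by apply: near_b => /=; move: xs; rewrite /ball/=; lra.
  have bt : `|b s - b t| < e / 2.
    apply: near_b => /=.
    have xs' : `|s - x| < dl / 2 := xs.
    have xt' : `|x - t| < dl / 2 := le_lt_trans xt Ke.
    by apply: le_lt_trans (ler_distD x s t) _; move: xs' xt'; clear; lra.
  have := ler_distD (b s) (b x) (b t); rewrite [`|b x - b s|]distrC; lra.
by move=> /(_ _ loc); apply: filterS => K h s sT; exact: h.
Qed.

End path_regularity.

(** * Fatou's lemma for a possibly nonmeasurable minorant *)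

Section lower_integral.
Context {d : measure_display} {Om : measurableType d} {R : realType}.
Variable P : {measure set Om -> \bar R}.
Implicit Types F G : Om -> \bar R.
Local Open Scope ereal_scope.

(* Integrals of nonnegative functions are suprema over simple minorants, so
   F need not be measurable. *)
Lemma ge0_ae_le_integral F G : (forall w, 0 <= F w) -> (forall w, 0 <= G w) ->
  measurable_fun setT G -> {ae P, forall w, F w <= G w} ->
  \int[P]_w F w <= \int[P]_w G w.
Proof.
move=> F0 G0 mG [N [mN PN FG]].
(* Infinite on the exceptional null set, [G'] dominates F everywhere, has the same integral as G and
   stays measurable. *)
pose G' w := if w \in N then +oo else G w.
have mG' : measurable_fun setT G'.
  apply: measurable_fun_ifT => //.
  apply: (measurable_fun_bool true).
  rewrite (_ : _ @^-1` _ = N) ?setTI//.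
  by apply/seteqP; split => w /= h; [exact: set_mem h|exact: mem_set h].
have G'0 w : 0 <= G' w by rewrite /G'; case: ifP.
have -> : \int[P]_w G w = \int[P]_w G' w.
  apply: ge0_ae_eq_integral => //; exists N; split => // w /=.
  apply: contra_notP => nN _; rewrite /G'.
  by case: ifPn => //; rewrite inE.
rewrite !ge0_integralTE//; apply: le_ereal_sup => _ [f /= fF <-].
exists f => // w; apply: le_trans (fF w) _.
rewrite /G'; case: ifPn => [_|]; first exact: leey.
rewrite notin_setE => nN; apply: contrapT => h; apply: nN; apply: FG.
by move=> /= FGw; apply: h.
Qed.

Lemma le_limn_einf (u : (\bar R)^nat) (x : \bar R) :
  (\forall n \near \oo, x <= u n) -> x <= limn_einf u.
Proof.
move=> [N _ xu]; rewrite limn_einf_lim; apply: lime_ge; first exact: is_cvg_einfs.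
exists N => // n /= Nn; apply: le_ereal_inf_tmp => _ [k /= nk <-].
by apply: xu => /=; exact: leq_trans nk.
Qed.

Lemma limn_einf_le (u : (\bar R)^nat) (x : \bar R) :
  (forall n, u n <= x) -> limn_einf u <= x.
Proof.
move=> ux; rewrite limn_einf_lim; apply: lime_le; first exact: is_cvg_einfs.
by apply: nearW => n; apply: ereal_inf_le; exists (u n) => //; exists n => /=.
Qed.

(** F will be the power of the error, of unknown measurability. It lies almost surely below the
    lower limit of the measurable [u n], and Fatou's lemma is applied to these. *)
Lemma fatou_bound (F : Om -> \bar R) (u : nat -> Om -> \bar R) (c : \bar R) :
  (forall w, 0 <= F w) -> (forall n w, 0 <= u n w) ->
  (forall n, measurable_fun setT (u n)) ->
  {ae P, forall w, \forall n \near \oo, F w <= u n w} ->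
  (forall n, \int[P]_w u n w <= c) -> \int[P]_w F w <= c.
Proof.
move=> F0 u0 mu Fu uc.
apply: (@le_trans _ _ (\int[P]_w limn_einf (u^~ w))).
  apply: ge0_ae_le_integral => //.
  - by move=> w; apply: le_limn_einf; apply: nearW => n.
  - apply: measurableT_comp => //; apply: measurable_fun_limn_esup => n.
    exact: measurableT_comp.
  - by move: Fu; apply: filterS => w; exact: le_limn_einf.
apply: le_trans (fatou _ _ _ _) _ => //.
exact: limn_einf_le.
Qed.

End lower_integral.

(** * Brownian increments on a uniform grid *)

Section brownian_grid.
Context {d : measure_display} {Om : measurableType d} {R : realType}.
Variables (P : probability Om R) (B : R -> Om -> R).
Hypothesis bm : brownian_motion P B.

Let set_inE (X : Om -> R) (A : set R) : [set w | X w \in A] = X @^-1` A.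
Proof. by apply/seteqP; split => w /= h; [exact: set_mem h|exact: mem_set h]. Qed.

Lemma measurable_brownian_increment s t : 0 <= s -> 0 <= t ->
  measurable_fun setT (fun w => B t w - B s w).
Proof. by case: bm => mB _ s0 t0; apply: measurable_funB; exact: mB. Qed.

Lemma brownian_increment_law s t A : 0 <= s -> s < t -> measurable A ->
  P ((fun w => B t w - B s w) @^-1` A) = normal_prob 0 (Num.sqrt (t - s)) A.
Proof. by case: bm => _ [_ [law _]] s0 st mA; rewrite -law// -set_inE. Qed.

Lemma brownian_moment_le s t k : 0 <= s -> s <= t ->
  (\int[P]_w ((B t w - B s w) ^+ (2 * k))%:E <=
   (gaussian_moment_cst k * (t - s) ^+ k)%:E)%E.
Proof.
move=> s0; rewrite le_eqVlt => /predU1P[->|st].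
  rewrite (eq_integral (cst ((0 : R) ^+ (2 * k))%:E)) => [|w _]; last by rewrite subrr.
  rewrite integral_cst//= probability_setT mule1 lee_fin subrr exprM expr0n/=.
  case: k => [|k]; last by rewrite !expr0n/= mulr0.
  by rewrite !expr0 mulr1 /gaussian_moment_cst expr0 fact0; lra.
have t0 : 0 <= t by rewrite (le_trans s0)// ltW.
have st0 : 0 < t - s by rewrite subr_gt0.
have sq0 : 0 < Num.sqrt (t - s) by rewrite sqrtr_gt0.
have := gaussian_moment_le P _ _ sq0 (measurable_brownian_increment s t s0 t0)
  (fun A mA => brownian_increment_law s t A s0 st mA) k.
by rewrite [in X in (_ <= X)%E]exprM sqr_sqrtr// ltW.
Qed.

Variable h : R.
Hypothesis h0 : 0 < h.

Definition increment (i : nat) (w : Om) : R := B (i.+1%:R * h) w - B (i%:R * h) w.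

Let ih0 i : 0 <= i%:R * h. Proof. by rewrite mulr_ge0// ltW. Qed.
Let ihS i : i%:R * h < i.+1%:R * h. Proof. by rewrite ltr_pM2r// ltr_nat. Qed.

Lemma measurable_increment i : measurable_fun setT (increment i).
Proof. exact: measurable_brownian_increment. Qed.

Lemma increment_law i A : measurable A ->
  P (increment i @^-1` A) = normal_prob 0 (Num.sqrt h) A.
Proof.
move=> mA; have hE : i.+1%:R * h - i%:R * h = h by rewrite -natr1; ring.
have := brownian_increment_law (i%:R * h) (i.+1%:R * h) A (ih0 i) (ihS i) mA.
by rewrite hE.
Qed.

Lemma increment_independent n (A : nat -> set R) : (forall i, measurable (A i)) ->
  P (\bigcap_(i in [set k | (k < n)%N]) (increment i @^-1` A i)) =
  (\prod_(i < n) P (increment i @^-1` A i))%E.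
Proof.
move=> mA; case: bm => _ [_ [_ indep]].
have := indep n (fun i => i%:R * h) (ih0 0) (fun i _ => ihS i) A mA.
under eq_bigcapr do rewrite set_inE.
by under [X in _ = X -> _]eq_bigr do rewrite set_inE.
Qed.

Lemma sum_increment m n w :
  \sum_(j < n) increment (m + j) w = B ((m + n)%:R * h) w - B (m%:R * h) w.
Proof.
elim: n => [|n IH]; first by rewrite big_ord0 addn0 subrr.
by rewrite big_ord_recr/= IH addnS /increment; ring.
Qed.

End brownian_grid.

Lemma exists_argmax {R : realType} (x : nat -> R) M :
  exists2 k, (k <= M)%N & forall m, (m <= M)%N -> x m <= x k.
Proof.
elim: M => [|M [k kM xk]]; first by exists 0%N => // m; rewrite leqn0 => /eqP ->.
case/orP: (le_total (x k) (x M.+1)) => kS.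
  exists M.+1 => // m; rewrite leq_eqVlt ltnS => /predU1P[->//|/xk h].
  exact: le_trans h kS.
exists k; first exact: leqW.
by move=> m; rewrite leq_eqVlt ltnS => /predU1P[->//|/xk].
Qed.

(** * The scheme on the refined grid: majorant and pathwise bound *)

Section scheme.
Context {d : measure_display} {Om : measurableType d} {R : realType}.
Variables (P : probability Om R) (B : R -> Om -> R).
Hypothesis bm : brownian_motion P B.
Variables (H H1 : R -> R) (L mu T y0 : R) (M : nat) (YLS : nat -> Om -> R).
Hypothesis L0 : 0 <= L.
Hypothesis T0 : 0 < T.
Hypothesis M0 : (0 < M)%N.
Hypothesis Hmu : forall x, `|H x + mu| <= L.
Hypothesis Hlip : forall x y, `|H x - H y| <= L * `|x - y|.
Hypothesis H1L : forall x, `|H1 x| <= L.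
Hypothesis mH1 : measurable_fun setT H1.
Hypothesis Htaylor : forall a x, `|H (a + x) - H a - H1 a * x| <= L * x ^+ 2.
Let dt := T / M%:R.
Let tm (m : nat) := m%:R * dt.
Hypothesis YLS0 : forall w, YLS 0%N w = y0.
Hypothesis YLSS : forall m w, (m < M)%N -> exists y : R -> R,
  y (tm m) = YLS m w /\ (forall t : R, is_derive t (1 : R) y (H (y t))) /\
  YLS m.+1 w = y (tm m.+1) + mu * dt + B (tm m.+1) w - B (tm m) w.

Variable K : nat.
Hypothesis K0 : (0 < K)%N.
Let h := dt / K%:R.

Let M0R : 0 < M%:R :> R. Proof. by rewrite ltr0n. Qed.
Let K0R : 0 < K%:R :> R. Proof. by rewrite ltr0n. Qed.
Let dt0 : 0 < dt. Proof. by rewrite divr_gt0. Qed.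
Let h0 : 0 < h. Proof. by rewrite divr_gt0. Qed.
Let MdtE : M%:R * dt = T. Proof. by rewrite mulrC divfK// gt_eqF. Qed.
Let KhE : K%:R * h = dt. Proof. by rewrite mulrC divfK// gt_eqF. Qed.
Let NhE : h *+ (M * K) = T.
Proof. by rewrite -mulr_natl natrM -mulrA KhE MdtE. Qed.
Let tmE m j : (m * K + j)%:R * h = tm m + j%:R * h.
Proof. by rewrite natrD natrM mulrDl -mulrA KhE. Qed.
Let tmE0 m : (m * K)%:R * h = tm m. Proof. by rewrite natrM -mulrA KhE. Qed.
Let tmS m : tm m.+1 = tm m + dt. Proof. by rewrite /tm -natr1; ring. Qed.
Let tm0 m : 0 <= tm m. Proof. by rewrite mulr_ge0// ltW. Qed.
Let tmT m : (m <= M)%N -> tm m <= T.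
Proof. by move=> mM; rewrite -MdtE ler_wpM2r ?ler_nat// ltW. Qed.
Let dtT : dt <= T.
Proof. by rewrite ler_pdivrMr// ler_peMr ?ler1n// ltW. Qed.
Let hT : h <= T.
Proof. by apply: le_trans dtT; rewrite ler_pdivrMr// ler_peMr ?ler1n// ltW. Qed.

Local Notation D := (increment B h).

(** Without its Brownian increment, the new value is the flow applied to [YLS m]. The flow is given
    by an existential for each path separately; its Lipschitz estimate between two paths is enough
    for [past_fun_lipschitz]. *)
Lemma scheme_past m n : (m <= M)%N -> (m * K <= n)%N -> past_fun D n (YLS m).
Proof.
elim: m n => [|m IH] n mM mn.
  by rewrite (_ : YLS 0 = (fun=> y0)); [exact: past_fun_cst|apply/funext].
have mn' : (m * K <= n)%N by rewrite (leq_trans _ mn)// leq_mul2r leqnSn orbT.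
have pm := IH n (ltnW mM) mn'.
pose X' w := YLS m.+1 w - (mu * dt + (B (tm m.+1) w - B (tm m) w)).
have pX' : past_fun D n X'.
  apply: (past_fun_lipschitz D n (YLS m) X' (expR (L * dt))) => //; first exact: expR_gt0.
  move=> w w'; have [y [yw [Dy Yw]]] := YLSS m w mM.
  have [z [zw [Dz Zw]]] := YLSS m w' mM.
  have -> : X' w = y (tm m.+1) by rewrite /X' Yw; ring.
  have -> : X' w' = z (tm m.+1) by rewrite /X' Zw; ring.
  have st : tm m <= tm m.+1 by rewrite tmS lerDl ltW.
  have := flow_lipschitz H L Hlip y z (tm m) (tm m.+1) st Dy Dz.
  by rewrite yw zw tmS addrAC subrr add0r.
rewrite (_ : YLS m.+1 = (fun w => X' w + (mu * dt + \sum_(j < K) D (m * K + j) w))).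
  apply: past_funD => //; apply: past_funD; first exact: past_fun_cst.
  apply: (past_fun_sum D n K (fun j => D (m * K + j))) => j jK.
  by apply: past_fun_D; rewrite (leq_trans _ mn)// mulSn addnC ltn_add2r.
apply/funext => w; rewrite sum_increment tmE0 tmE KhE -tmS /X'; ring.
Qed.

(** Fine increment i belongs to step i / K and enters the Riemann sum of that step at its K - (i mod
    K) - 1 later nodes; the weight h splits into dt, kept outside, and 1 / K. The value 0 past the
    horizon makes the coefficient bounded and predictable for every i, since [YLS] is controlled up
    to M only. *)
Definition martingale_coef (i : nat) (w : Om) : R :=
  if (i < M * K)%N then H1 (YLS (i %/ K) w) * ((K - (i %% K).+1)%:R / K%:R) else 0.
Local Notation a := martingale_coef.

Lemma martingale_coef_past i n : (i <= n)%N -> past_fun D n (a i).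
Proof.
move=> iln; have [iMK|iMK] := boolP (i < M * K)%N; last first.
  rewrite (_ : a i = (fun=> 0)); first exact: past_fun_cst.
  by apply/funext => w; rewrite /a (negbTE iMK).
rewrite (_ : a i = (fun w => H1 (YLS (i %/ K) w) * ((K - (i %% K).+1)%:R / K%:R))); last first.
  by apply/funext => w; rewrite /a iMK.
apply: past_funM; last exact: past_fun_cst.
apply: past_fun_comp => //; apply: scheme_past.
  by apply: ltnW; rewrite ltn_divLR.
by rewrite (leq_trans (leq_divM _ _)).
Qed.

Lemma martingale_coef_le i w : `|a i w| <= L.
Proof.
rewrite /a; case: ifP => _; last by rewrite normr0.
rewrite normrM -[L]mulr1; apply: ler_pM => //.
rewrite ger0_norm ?divr_ge0// ler_pdivrMr// mul1r ler_nat leq_subr//.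
Qed.

Definition node_increment (m i : nat) (w : Om) : R := B (tm m + i%:R * h) w - B (tm m) w.
Local Notation beta := node_increment.

Lemma transform_node m w : (m < M)%N ->
  dt * transform D a (m.+1 * K) w - dt * transform D a (m * K) w =
  H1 (YLS m w) * (h * \sum_(i < K) beta m i w).
Proof.
move=> mM; rewrite -mulrBr /transform.
have -> : \sum_(j < m.+1 * K) a j w * D j w =
    \sum_(j < m * K) a j w * D j w + \sum_(j < K) a (m * K + j) w * D (m * K + j) w.
  by rewrite mulSn addnC big_split_ord.
rewrite addrAC subrr add0r.
have -> : \sum_(i < K) beta m i w = \sum_(i < K) \sum_(j < i) D (m * K + j) w.
  by apply: eq_bigr => i _; rewrite sum_increment tmE tmE0.
rewrite (sum_partial_sums (fun j => D (m * K + j) w)) !mulr_sumr.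
apply: eq_bigr => j _; rewrite /a.
have jlt : (m * K + j < M * K)%N.
  by rewrite (leq_trans _ (leq_mul mM (leqnn K)))// mulSn addnC ltn_add2r.
rewrite jlt divnMDl// divn_small// addn0 modnMDl modn_small// /h.
by field; rewrite gt_eqF.
Qed.

(** Each of the M terms has size dt^2, so after division by dt the total is of order T. *)
Definition quadratic_term (w : Om) : R := (\sum_(m < M) h * \sum_(i < K) beta m i w ^+ 2) / dt.

Lemma quadratic_term_ge0 w : 0 <= quadratic_term w.
Proof.
rewrite divr_ge0 ?(ltW dt0)// sumr_ge0// => m _; rewrite mulr_ge0 ?(ltW h0)//.
by rewrite sumr_ge0// => i _; exact: sqr_ge0.
Qed.

Let mbeta m i : measurable_fun setT (beta m i).
Proof.
have ti : 0 <= tm m + i%:R * h by rewrite addr_ge0// mulr_ge0// ltW.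
exact: (measurable_brownian_increment P B bm (tm m) _ (tm0 m) ti).
Qed.

Lemma measurable_quadratic_term : measurable_fun setT quadratic_term.
Proof.
apply: measurable_funM => //; apply: measurable_sum => m; apply: measurable_funM => //.
by apply: measurable_sum => i; apply: measurable_funX; exact: mbeta.
Qed.

(** Since h / dt = 1 / K, the quadratic term is M times the mean of beta^2 over all M K nodes.
    Jensen brings the power inside the mean, and M^q dt^q = T^q removes the dependence on the
    grid. *)
Lemma quadratic_term_moment q : ~~ odd q ->
  (\int[P]_w (quadratic_term w ^+ q)%:E <= (gaussian_moment_cst q * T ^+ q)%:E)%E.
Proof.
move=> eq.
pose c : R := M%:R ^+ q / (M * K)%:R.
have c0 : 0 <= c by rewrite divr_ge0// exprn_ge0.
have b0 m i w : 0 <= beta m i w ^+ (2 * q) by rewrite exprM exprn_ge0// sqr_ge0.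
have mb m i : measurable_fun setT (fun w => beta m i w ^+ (2 * q)).
  by apply: measurable_funX; exact: mbeta.
apply: (@le_trans _ _ (\int[P]_w (c * \sum_(m < M) \sum_(i < K) beta m i w ^+ (2 * q))%:E)%E).
  apply: ge0_le_integral_real => //.
  - by move=> w; rewrite exprn_ge0// quadratic_term_ge0.
  - by apply: measurable_funX; exact: measurable_quadratic_term.
  - by apply: measurable_funM => //; apply: measurable_sum => m; apply: measurable_sum.
  move=> w; rewrite /quadratic_term.
  have := @mean_exprn_even R ('I_M * 'I_K)%type (fun p => beta p.1 p.2 w ^+ 2) q.
  rewrite card_prod !card_ord => /(_ _ eq); rewrite muln_gt0 M0 K0 => /(_ isT).
  rewrite -(pair_big xpredT xpredT (fun (m : 'I_M) (i : 'I_K) => beta m i w ^+ 2))/=.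
  rewrite (eq_bigr (fun p : 'I_M * 'I_K => beta p.1 p.2 w ^+ (2 * q))); last first.
    by move=> p _; rewrite -exprM.
  rewrite -(pair_big xpredT xpredT (fun (m : 'I_M) (i : 'I_K) => beta m i w ^+ (2 * q)))/=.
  rewrite -mulr_sumr; set S1 := \sum_(_ < _) _; set S2 := \sum_(_ < _) _ => mean.
  have -> : h * S1 / dt = M%:R * (S1 / (M * K)%:R).
    by rewrite natrM /h; field; rewrite !gt_eqF//= ltW.
  by rewrite exprMn /c mulrAC -mulrA ler_wpM2l// exprn_ge0.
rewrite ge0_integralZl_real//; last 2 first.
  by move=> w; do 2 (apply: sumr_ge0 => ? _).
  by apply: measurable_sum => m; apply: measurable_sum.
rewrite (ge0_integral_sum_real P (fun m w => \sum_(i < K) beta m i w ^+ (2 * q)))//; last 2 first.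
  by move=> m w; apply: sumr_ge0.
  by move=> m; apply: measurable_sum.
apply: (@le_trans _ _ (c%:E * \sum_(m < M) \sum_(i < K) (gaussian_moment_cst q * dt ^+ q)%:E)%E).
  rewrite lee_wpmul2l ?lee_fin//; apply: lee_sum => m _.
  rewrite (ge0_integral_sum_real P (fun i w => beta m i w ^+ (2 * q)))//.
  apply: lee_sum => i _.
  have ih : 0 <= i%:R * h by rewrite mulr_ge0// ltW.
  have := brownian_moment_le P B bm (tm m) (tm m + i%:R * h) q (tm0 m).
  rewrite lerDl ih => /(_ isT) /le_trans; apply.
  rewrite lee_fin ler_wpM2l ?gaussian_moment_cst_ge0// addrAC subrr add0r.
  rewrite lerXn2r ?nnegrE// ?(ltW dt0)// -KhE ler_wpM2r ?(ltW h0)// ler_nat ltnW//.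
under eq_bigr do rewrite sumEFin.
rewrite sumEFin -EFinM lee_fin !sumr_const !card_ord -mulrnA -mulr_natl.
have TE : T ^+ q = M%:R ^+ q * dt ^+ q by rewrite -exprMn MdtE.
have MK0 : (K * M)%:R != 0 :> R by rewrite pnatr_eq0 -lt0n muln_gt0 K0.
rewrite /c TE mulnC le_eqVlt; apply/orP; left; apply/eqP.
by rewrite mulrA divfK//; ring.
Qed.

Variable n : nat.
Hypothesis n0 : (0 < n)%N.
Hypothesis en : ~~ odd n.
Local Notation c1 := (local_error_cst L mu).

Definition majorant (w : Om) : R :=
  running_max D a n (M * K) w ^+ 2 + (c1 * T) ^+ (2 * n) + L ^+ (2 * n) * quadratic_term w ^+ (2 * n).

Let even2n : ~~ odd (2 * n). Proof. by rewrite oddM. Qed.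

Let mD i : measurable_fun setT (D i). Proof. exact: (measurable_increment P). Qed.

Let mrunning_max : measurable_fun setT (running_max D a n (M * K)).
Proof. exact: (measurable_running_max D mD a martingale_coef_past). Qed.

Let c1T0 : 0 <= (c1 * T) ^+ (2 * n).
Proof. by rewrite exprM exprn_ge0// sqr_ge0. Qed.

Let quad0 w : 0 <= L ^+ (2 * n) * quadratic_term w ^+ (2 * n).
Proof. by rewrite mulr_ge0// exprn_ge0// quadratic_term_ge0. Qed.

Lemma majorant_ge0 w : 0 <= majorant w.
Proof. by rewrite addr_ge0// addr_ge0// sqr_ge0. Qed.

Lemma measurable_majorant : measurable_fun setT majorant.
Proof.
apply: measurable_funD; first by apply: measurable_funD => //; exact: measurable_funX.
by apply: measurable_funM => //; apply: measurable_funX; exact: measurable_quadratic_term.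
Qed.

Definition majorant_cst : R := 4 * expR (transform_rate L T n * T) + (c1 * T) ^+ (2 * n)
  + L ^+ (2 * n) * (gaussian_moment_cst (2 * n) * T ^+ (2 * n)).

Lemma majorant_integral : (\int[P]_w (majorant w)%:E <= majorant_cst%:E)%E.
Proof.
have mq : measurable_fun setT (fun w => quadratic_term w ^+ (2 * n)).
  by apply: measurable_funX; exact: measurable_quadratic_term.
rewrite ge0_integralD_real//; first last.
- exact: measurable_funM.
- by apply: measurable_funD => //; exact: measurable_funX.
- by move=> w; rewrite addr_ge0// sqr_ge0.
rewrite ge0_integralD_real//; first last.
- exact: measurable_funX.
- by move=> w; exact: sqr_ge0.
rewrite integral_cst//= probability_setT mule1 ge0_integralZl_real//; first last.
- by move=> w; rewrite exprn_ge0// quadratic_term_ge0.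
- by rewrite exprn_ge0.
rewrite /majorant_cst !EFinD; apply: leeD; first apply: leeD => //.
  have := transform_maximal P D h h0 mD (increment_independent P B bm h h0)
    (increment_law P B bm h h0) a L T L0 hT martingale_coef_past martingale_coef_le
    n (M * K) n0 en.
  by rewrite NhE.
rewrite [X in (_ <= X)%E]EFinM lee_wpmul2l ?lee_fin ?exprn_ge0//.
exact: quadratic_term_moment.
Qed.

(** Every term of [global_error] carries a factor dt, which is divided out before taking powers. The
    4 stands for two splittings of a sum inside the power 2n, each costing 2^(2n). *)
Lemma pathwise_bound w (Y : R -> R) :
  {within `[0, T], continuous (fun t => Y t - B t w)} ->
  (forall t : R, 0 < t < T -> is_derive t (1 : R) (fun t => Y t - B t w) (H (Y t) + mu)) ->
  Y 0 = y0 ->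
  (forall s : R, s \in `[0, T] -> forall t : R, `|s - t| <= h -> `|B s w - B t w| <= dt) ->
  forall m, (m <= M)%N ->
  (`|YLS m w - Y (tm m)| / dt) ^+ (2 * n) <= (4 * expR (L * T)) ^+ (2 * n) * majorant w.
Proof.
move=> Vc VD Y0 modulus.
pose e m := YLS m w - Y (tm m).
pose Z m := dt * transform D a (m * K) w.
pose q m := h * \sum_(i < K) beta m i w ^+ 2.
(* Only the times t_m matter here; as the maximum is attained, its n-th power is one of the terms of
   the running maximum over the fine grid. *)
have [k kM kmax] := exists_argmax (fun m => `|transform D a (m * K) w|) M.
pose sg := `|transform D a (k * K) w|.
have q0 m : 0 <= q m.
  by rewrite mulr_ge0 ?(ltW h0)// sumr_ge0// => i _; exact: sqr_ge0.
have e0 : e 0%N = 0 by rewrite /e YLS0 /tm mul0r Y0 subrr.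
have Z0 : Z 0%N = 0 by rewrite /Z mul0n /transform big_ord0 mulr0.
have step m : (m < M)%N -> `|e m.+1 - e m + (Z m.+1 - Z m)|
     <= dt * L * `|e m| + c1 * dt ^+ 2 + L * q m.
  move=> mM; have [y [ym [yD yS]]] := YLSS m w mM.
  have tS : tm m + dt <= T by rewrite -tmS tmT.
  have sub : `[tm m, tm m + dt] `<=` `[0, T] by apply: subset_itv; rewrite bnd_simp.
  have Vc' := continuous_subspaceW sub Vc.
  have VD' t : t \in `]tm m, tm m + dt[ ->
      is_derive t (1 : R) (fun t => Y t - B t w) (H (Y t) + mu).
    rewrite in_itv/= => /andP[t1 t2]; apply: VD.
    by rewrite (le_lt_trans (tm0 m) t1) (lt_le_trans t2 tS).
  have md s t : s \in `[tm m, tm m + dt] -> t \in `[tm m, tm m + dt] ->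
      `|s - t| <= dt / K%:R -> `|B s w - B t w| <= dt.
    by move=> sI _; apply: modulus; exact: sub sI.
  have := step_error H H1 L mu L0 Hmu Hlip Htaylor (tm m) dt K (B^~ w) Y y dt0 K0 Vc' VD' yD md.
  rewrite -tmS ym.
  have -> : y (tm m.+1) + mu * dt + B (tm m.+1) w - B (tm m) w = YLS m.+1 w by [].
  by rewrite /Z transform_node.
have Zs m : (m <= M)%N -> `|Z m| <= dt * sg.
  by move=> mM; rewrite normrM gtr0_norm// ler_wpM2l ?(ltW dt0)// kmax.
have c10 : 0 <= c1 by exact: local_error_cst_ge0.
have glob := @global_error R L c1 dt e Z q (dt * sg) M L0 c10 (ltW dt0)
  (mulr_ge0 (ltW dt0) (normr_ge0 _)) q0 e0 Z0 step Zs.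
move=> m mM; have := glob m mM; rewrite MdtE.
have -> : \sum_(j < M) q j = dt * quadratic_term w.
  by rewrite /quadratic_term mulrC divfK// gt_eqF.
set E := expR (L * T); set Qw := quadratic_term w => em.
have E0 : 0 <= E by exact: expR_ge0.
have Q0 : 0 <= Qw by exact: quadratic_term_ge0.
have LQ0 : 0 <= L * Qw by exact: mulr_ge0.
have cT0 : 0 <= c1 * T by rewrite mulr_ge0// ltW.
have sg0 : 0 <= sg by exact: normr_ge0.
have r0 : 0 <= c1 * T + L * Qw := addr_ge0 cT0 LQ0.
have lhs0 : 0 <= `|e m| / dt by rewrite divr_ge0// ltW.
have rhs0 : 0 <= E * (sg + (c1 * T + L * Qw)) := mulr_ge0 E0 (addr_ge0 sg0 r0).
apply: (@le_trans _ _ ((E * (sg + (c1 * T + L * Qw))) ^+ (2 * n))).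
  rewrite lerXn2r ?nnegrE//.
  rewrite ler_pdivrMr//; apply: le_trans em _.
  by rewrite le_eqVlt; apply/orP; left; apply/eqP; ring.
have sgq : sg ^+ (2 * n) <= running_max D a n (M * K) w ^+ 2.
  rewrite mulnC exprM /sg -normrX ger0_norm ?exprn_even_ge0//.
  rewrite lerXn2r ?nnegrE ?exprn_even_ge0 ?running_max_ge0//.
  by apply: running_max_ge; rewrite leq_mul2r kM orbT.
have split1 := exprDn_le_cst sg (c1 * T + L * Qw) (2 * n) sg0 r0.
have split2 := exprDn_le_cst (c1 * T) (L * Qw) (2 * n) cT0 LQ0.
rewrite !exprMn [4 ^+ _ * _]mulrC -mulrA ler_wpM2l ?exprn_ge0//.
have p1 : 1 <= 2 ^+ (2 * n) :> R by rewrite exprn_ege1// ler1n.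
have -> : 4 ^+ (2 * n) = 2 ^+ (2 * n) * 2 ^+ (2 * n) :> R by rewrite -exprMn -natrM.
apply: le_trans split1 _; rewrite -mulrA ler_wpM2l ?exprn_ge0//.
rewrite /majorant -addrA mulrDr; apply: lerD.
  apply: le_trans sgq _; rewrite ler_peMl ?sqr_ge0//.
by rewrite -exprMn.
Qed.

End scheme.

(** * Conclusion: from even moments of the transformed error to the p-th moment *)

Lemma norm_le_sup_range {R : realType} (u : R -> R) (M : R) :
  (forall x, `|u x| <= M) -> forall x, `|u x| <= sup (range (fun x => `|u x|)).
Proof.
move=> uM x; apply: ub_le_sup; last by exists x.
by exists M => _ [z _ <-].
Qed.

Lemma powR_le1D_exprn {R : realType} (u p : R) q : 0 <= u -> 0 <= p -> p <= q%:R ->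
  u `^ p <= 1 + u ^+ q.
Proof.
move=> u0 p0 pq; have [u1|u1] := leP u 1.
  apply: (@le_trans _ _ (1 `^ p)); first by rewrite ge0_ler_powR ?nnegrE.
  by rewrite powR1 lerDl exprn_ge0.
apply: (@le_trans _ _ (u `^ q%:R)); first by rewrite ler_powR// ltW.
by rewrite powR_mulrn// lerDr.
Qed.

Theorem theorem3p2 (R : realType) (p : R) (hp : 1 <= p) (T : R) (hT : 0 < T)
  (mu LPhi LH : R) :
  exists C : R, forall (l r : R) (f g : R -> R) (w0 x0 : R) (Phiinv : R -> R)
    (M : nat) (d : measure_display) (Om : measurableType d)
    (P : probability Om R) (B : R -> Om -> R) (Y : R -> Om -> R)
    (YLS : nat -> Om -> R),
  l < r ->
  (* (A1) *) Ck_on l r 2 f ->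
  (* (A2) *) Ck_on l r 3 g ->
  (forall x, l < x < r -> 0 < g x) ->
  l < w0 < r ->
  Phi g w0 x @[x --> l^'+] --> -oo ->
  Phi g w0 x @[x --> r^'-] --> +oo ->
  (* (A3) *) (exists a : R, (fun x => f x / g x) @ l^'+ --> a) ->
  (exists b : R, (fun x => f x / g x) @ r^'- --> b) ->
  (* Phiinv is the inverse of Phi : (l,r) -> R, LPhi-Lipschitz *)
  (forall y, l < Phiinv y < r /\ Phi g w0 (Phiinv y) = y) ->
  (forall x y, `|Phiinv x - Phiinv y| <= LPhi * `|x - y|) ->
  (* L_H *)
  let Ht := Htilde f g Phiinv in
  let H := fun x => Ht x - mu in
  LH = sup (range (fun x => `|H x + mu|)) + sup (range (fun x => `|derive1 H x|))
       + sup (range (fun x => `|derive1 (derive1 H) x|)) ->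
  (0 < M)%N ->
  l < x0 < r ->
  brownian_motion P B ->
  let dt := T / M%:R in
  let tm := fun m : nat => m%:R * dt in
  (* exact solution (Lamperti transformed) *)
  {ae P, forall w, {within `[0, T], continuous (Y^~ w)} /\
     forall t, 0 <= t <= T ->
       Y t w = Phi g w0 x0 + Rintegral lebesgue_measure `[0, t] (fun s => Ht (Y s w))
               + B t w} ->
  (* semi-analytic Lamperti-splitting scheme *)
  (forall w, YLS 0%N w = Phi g w0 x0) ->
  (forall m w, (m < M)%N -> exists y : R -> R,
     y (tm m) = YLS m w /\ (forall t : R, is_derive t (1 : R) y (H (y t))) /\
     YLS m.+1 w = y (tm m.+1) + mu * dt + B (tm m.+1) w - B (tm m) w) ->
  ((\int[P]_w ((\big[Num.max/0]_(m < M.+1)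
        `|Phiinv (YLS m w) - Phiinv (Y (tm m) w)|) `^ p)%:E) `^ p^-1
     <= (C * dt)%:E)%E.
Proof.
have p0 : 0 < p := lt_le_trans ltr01 hp.
(* The moment used has order 2n with n itself even: Doob's L2 inequality is applied to n-th powers,
   which have to be nonnegative. *)
pose k := (Num.truncn p).+1.
have pk : p <= k%:R by rewrite ltW// truncnS_gt.
pose n := (2 * k)%N.
have n0 : (0 < n)%N by rewrite /n muln_gt0.
have en : ~~ odd n by rewrite /n oddM.
have pq : p <= (2 * n)%:R by rewrite (le_trans pk)// ler_nat /n; lia.
pose A : R := (LPhi * (4 * expR (LH * T))) ^+ (2 * n).
have A0 : 0 <= A by rewrite /A exprM exprn_ge0// sqr_ge0.
(* The 1 comes from u^p <= 1 + u^(2n), and [A] from the Lipschitz constant of [Phiinv] and the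
   factor in [pathwise_bound]. No p-th root is needed: the constant is at least 1, so its power 1/p
   does not exceed it. *)
exists (1 + A * majorant_cst LH mu T n).
move=> l r f g w0 x0 Phiinv M d Om P B Y YLS lr Cf Cg g0 lw0r _ _ fgl fgr PhiK Plip.
move=> Ht H LHE M0 _ bm dt tm solY YLS0 YLSS.
have dt0 : 0 < dt by rewrite divr_gt0// ltr0n.
have LPhi0 : 0 <= LPhi.
  by have := Plip 1 0; rewrite subr0 normr1 mulr1; exact: le_trans (normr_ge0 _).
have [H1 [H2 [HD1 HD2 [Mb HMb]]]] := Htilde_C2_bounded l r w0 f g Phiinv LPhi lr Cf Cg
  g0 lw0r fgl fgr PhiK Plip.
have HD x : is_derive x (1 : R) H (H1 x).
  by have ? := HD1 x; apply: is_derive_eq; rewrite subr0.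
have dH : derive1 H = H1 by apply/funext => x; have ? := HD x; rewrite derive1E derive_val.
have dH1 : derive1 H1 = H2 by apply/funext => x; have ? := HD2 x; rewrite derive1E derive_val.
rewrite dH dH1 in LHE.
have HE x : H x + mu = Ht x by rewrite /H subrK.
have S0 := norm_le_sup_range (fun x => H x + mu) Mb.
have S1 := norm_le_sup_range H1 Mb.
have S2 := norm_le_sup_range H2 Mb.
have {}S0 x : `|H x + mu| <= sup (range (fun x => `|H x + mu|)).
  by apply: S0 => z; rewrite HE; case: (HMb z).
have {}S1 x : `|H1 x| <= sup (range (fun x => `|H1 x|)).
  by apply: S1 => z; case: (HMb z).
have {}S2 x : `|H2 x| <= sup (range (fun x => `|H2 x|)).
  by apply: S2 => z; case: (HMb z).
have s0 := le_trans (normr_ge0 _) (S0 0).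
have s1 := le_trans (normr_ge0 _) (S1 0).
have s2 := le_trans (normr_ge0 _) (S2 0).
have Hmu x : `|H x + mu| <= LH by rewrite LHE (le_trans (S0 x))//; lra.
have H1L x : `|H1 x| <= LH by rewrite LHE (le_trans (S1 x))//; lra.
have H2L x : `|H2 x| <= LH by rewrite LHE (le_trans (S2 x))//; lra.
have LH0 : 0 <= LH := le_trans (normr_ge0 _) (H1L 0).
have Hlip := derive_bounded_lipschitz H H1 LH HD H1L.
have H1lip := derive_bounded_lipschitz H1 H2 LH HD2 H2L.
have Htay := derive_lipschitz_taylor H H1 LH HD H1lip.
have contD (u : R -> R) du : (forall x, is_derive x (1 : R) u (du x)) -> continuous u.
  by move=> Du x; apply/differentiable_continuous/derivable1_diffP; case: (Du x).
have mH1 : measurable_fun [set: R] H1.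
  by apply: continuous_measurable_fun; exact: contD HD2.
pose maj K := majorant B H1 LH mu T M YLS K.+1 n.
pose C : R := 1 + A * majorant_cst LH mu T n.
have maj0 K w : 0 <= maj K w by exact: majorant_ge0.
have mmaj K : measurable_fun setT (maj K).
  exact: (measurable_majorant P B bm H H1 LH mu T (Phi g w0 x0) M YLS).
have intmaj K : (\int[P]_w (maj K w)%:E <= (majorant_cst LH mu T n)%:E)%E.
  exact: (majorant_integral P B bm H H1 LH mu T (Phi g w0 x0) M YLS).
have cst0 : 0 <= majorant_cst LH mu T n.
  rewrite -lee_fin; apply: le_trans (intmaj 0%N).
  by apply: integral_ge0 => w _; rewrite lee_fin.
have C1 : 1 <= C by rewrite lerDl mulr_ge0.
have C0 : 0 <= C := le_trans ler01 C1.
set F := fun w : Om => _.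
have F0 w : (0 <= F w)%E by rewrite lee_fin powR_ge0.
have dtp0 : 0 <= dt `^ p := powR_ge0 _ _.
(* The factor dt^p is split off before u^p <= 1 + u^(2n) is used, so that the additive 1 does not
   spoil the order. *)
pose u K w : R := dt `^ p * (1 + A * maj K w).
have Am0 K w : 0 <= A * maj K w := mulr_ge0 A0 (maj0 K w).
have u0 K w : 0 <= u K w := mulr_ge0 dtp0 (addr_ge0 ler01 (Am0 K w)).
have mAm K : measurable_fun setT (fun w => A * maj K w) by exact: measurable_funM.
have mu1 K : measurable_fun setT (fun w => 1 + A * maj K w) by exact: measurable_funD.
have intu K : (\int[P]_w (u K w)%:E <= (dt `^ p * C)%:E)%E.
  rewrite ge0_integralZl_real//; last by move=> w; rewrite addr_ge0.
  rewrite ge0_integralD_real// integral_cst//= probability_setT mule1.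
  rewrite ge0_integralZl_real// EFinM lee_wpmul2l ?lee_fin// /C EFinD leeD2l//.
  by rewrite EFinM lee_wpmul2l ?lee_fin.
have intF : (\int[P]_w F w <= (dt `^ p * C)%:E)%E.
  apply: (fatou_bound P F (fun K w => (u K w)%:E)) => //.
  - by move=> K; apply/measurable_EFinP; exact: measurable_funM.
  case: bm => _ [Bc _]; move: Bc solY; apply: filterS2 => w [B0 Bc] [Yc YE].
  have := uniform_modulus (B^~ w) T dt dt0 Bc; apply: filterS => K modulus.
  have Htc : continuous Ht by exact: contD HD1.
  have kc : {within `[0, T], continuous (fun s => Ht (Y s w))}.
    by move=> x; exact: (continuous_comp (Yc x) (Htc _)).
  have VD (t : R) : 0 < t < T ->
      is_derive t (1 : R) (fun t => Y t w - B t w) (H (Y t w) + mu).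
    move=> tT; rewrite HE.
    exact: (integral_equation_is_derive (Y^~ w) (B^~ w) (fun s => Ht (Y s w)) _ T kc YE t tT).
  have Vc : {within `[0, T], continuous (fun t => Y t w - B t w)}.
    have Bc' : {within `[0, T], continuous (B^~ w)} by exact: continuous_subspaceT.
    have -> : (fun t => Y t w - B t w) = (Y^~ w) - (B^~ w) by apply/funext.
    by move=> x; apply: continuousB; [exact: Yc|exact: Bc'].
  have Y0 : Y 0 w = Phi g w0 x0.
    by rewrite YE ?lexx ?(ltW hT)// set_itv1 Rintegral_set1 B0 !addr0.
  have path := pathwise_bound B H H1 LH mu T (Phi g w0 x0) M YLS LH0 hT M0
    Hmu Hlip Htay YLS0 YLSS K.+1 isT n en w (Y^~ w) Vc VD Y0 modulus.
  rewrite lee_fin.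
  set X := \big[_/_]_(_ < _) _.
  have [X0 XA] : 0 <= X /\ (X / dt) ^+ (2 * n) <= A * maj K w.
    (* The bound does not depend on m and is stable under maxima, so it passes from the single times
       to the supremum at no cost. *)
    rewrite /X; apply: (big_ind (fun x : R => 0 <= x /\ (x / dt) ^+ (2 * n) <= A * maj K w)).
    - by split => //; rewrite mul0r expr0n (_ : (2 * n == 0)%N = false).
    - move=> x y [x_ge0 xA] [y_ge0 yA]; rewrite le_max x_ge0.
      by case: (leP x y).
    - move=> m _; split => //.
      have mM : (m <= M)%N by rewrite -ltnS.
      have := path m mM; set em := `|_| => em_le.
      have em0 : 0 <= em by exact: normr_ge0.
      apply: (@le_trans _ _ ((LPhi * (em / dt)) ^+ (2 * n))).
        have dtV : 0 <= dt^-1 by rewrite invr_ge0 ltW.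
        have emdt : 0 <= LPhi * (em / dt) := mulr_ge0 LPhi0 (mulr_ge0 em0 dtV).
        have xdt : 0 <= `|Phiinv (YLS m w) - Phiinv (Y (tm m) w)| / dt.
          by rewrite mulr_ge0.
        by rewrite lerXn2r ?nnegrE// mulrA ler_wpM2r// Plip.
      rewrite [leLHS]exprMn /A [(LPhi * (4 * _)) ^+ _]exprMn -mulrA.
      by rewrite ler_wpM2l// exprn_ge0.
  have U0 : 0 <= X / dt by rewrite divr_ge0// ltW.
  rewrite (_ : X = dt * (X / dt)); last by rewrite mulrC divfK// gt_eqF.
  rewrite powRM ?(ltW dt0)// ler_wpM2l//.
  apply: le_trans (powR_le1D_exprn _ _ _ U0 (ltW p0) pq) _.
  by rewrite lerD2l.
apply: (@le_trans _ _ ((dt `^ p * C)%:E `^ p^-1)%E).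
  apply: gt0_ler_poweR => //; first by rewrite invr_ge0 ltW.
  - rewrite in_itv/= leey andbT; apply: integral_ge0 => w _; exact: F0.
  - by rewrite in_itv/= leey andbT lee_fin mulr_ge0.
rewrite poweR_EFin lee_fin powRM ?powR_ge0// -powRrM divff ?gt_eqF// powRr1 ?(ltW dt0)//.
by rewrite mulrC ler_wpM2r ?(ltW dt0)// ler1_powR// invf_le1.
Qed.
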